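(* Let $K\subset\mathbb{R}$ be a number field and $S$ a finite set of finite places of $K$. The set of $\mathcal{O}_{K,S}$-points of the Teichmüller component $\mathcal{T}_{0,4}$ with trace field exactly $K$ is finite up to the action of the mapping class group of the four-punctured sphere if and only if $(K,S)=(\mathbb{Q},\emptyset)$.
   Context: Let $\Sigma$ be the four-punctured sphere, whose fundamental group is generated by simple loops around the punctures with monodromies denoted $A,B,C,D$, $ABCD=1$. The relative $\mathrm{SL}_2$-character variety of $\Sigma$ with all boundary traces equal to $2$ is, in the coordinates $X=\mathrm{Tr}(AB)$, $Y=\mathrm{Tr}(BC)$, $Z=\mathrm{Tr}(CA)$, the cubic surface $$V_2:\quad X^2+Y^2+Z^2+XYZ-8X-8Y-8Z+28=0.$$ Its Teichmüller component (the image of the Teichmüller space of marked complete hyperbolic structures on $\Sigma$, via holonomy) is $\mathcal{T}_{0,4}=\{(X,Y,Z)\in V_2(\mathbb{R}): X<-2,\ Y<-2,\ Z<-2\}$. The mapping class group $\mathrm{Mod}(\Sigma)$ acts on $V_2$, preserving $\mathcal{T}_{0,4}$, by precomposing representations with outer automorphisms of $\pi_1(\Sigma)$. Here $\mathcal{O}_{K,S}$ is the ring of $S$-integers of $K$, an $\mathcal{O}_{K,S}$-point is a point with $X,Y,Z\in\mathcal{O}_{K,S}$ (via $K\subset\mathbb{R}$), and the trace field of a point is the field generated over $\mathbb{Q}$ by all traces of the corresponding representation, which equals $\mathbb{Q}(X,Y,Z)$. (The paper calls the set of $\mathrm{Mod}(\Sigma)$-orbits of $\mathcal{O}_{K,S}$-points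 on the Teichmüller component the set of $\mathcal{O}_{K,S}$-Teichmüller points.) *)

(* Defs.v *)
From HB Require Import structures.
From mathcomp Require Import all_boot all_order all_algebra perm fieldext.
From mathcomp Require Import all_classical all_reals.

Set Implicit Arguments.
Unset Strict Implicit.
Unset Printing Implicit Defensive.

Import Order.TTheory GRing.Theory Num.Theory.

Local Open Scope classical_set_scope.
Local Open Scope quotient_scope.
Local Open Scope ring_scope.

(** The fundamental group < A, B, C, D | A B C D = 1 > of the four-punctured
    sphere. *)

(* The letter (i, false) is the i-th generator, (i, true) is its inverse. *)
Definition word := seq ('I_4 * bool).

Definition relator : word :=
  [:: (0, false); (1, false); (2, false); (3, false)].

Inductive word_eq : word -> word -> Prop :=
| word_eq_refl w : word_eq w w
| word_eq_sym w1 w2 : word_eq w1 w2 -> word_eq w2 w1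
| word_eq_trans w1 w2 w3 : word_eq w1 w2 -> word_eq w2 w3 -> word_eq w1 w3
| word_eq_cancel u v i b : word_eq (u ++ [:: (i, b); (i, ~~ b)] ++ v) (u ++ v)
| word_eq_relator u v : word_eq (u ++ relator ++ v) (u ++ v).

Definition word_eqb (w1 w2 : word) : bool := `[< word_eq w1 w2 >].

Lemma word_eqb_refl : reflexive word_eqb.
Proof. by move=> w; apply/asboolP; apply: word_eq_refl. Qed.

Lemma word_eqb_sym : symmetric word_eqb.
Proof. by move=> w1 w2; apply/asboolP/asboolP; apply: word_eq_sym. Qed.

Lemma word_eqb_trans : transitive word_eqb.
Proof.
by move=> w2 w1 w3 /asboolP h12 /asboolP h23; apply/asboolP/(word_eq_trans h12).
Qed.

Canonical word_eqb_equiv :=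
  EquivRel word_eqb word_eqb_refl word_eqb_sym word_eqb_trans.

Definition pi1 := {eq_quot word_eqb}.

HB.instance Definition _ := Choice.on pi1.
HB.instance Definition _ := EqQuotient.on pi1.

Definition word_inv (w : word) : word := rev [seq (x.1, ~~ x.2) | x <- w].

Lemma word_eq_cat2 p w1 w2 s :
  word_eq w1 w2 -> word_eq (p ++ w1 ++ s) (p ++ w2 ++ s).
Proof.
elim=> {w1 w2} [w|w1 w2 _ IH|w1 w2 w3 _ IH1 _ IH2|u v i b|u v].
- exact: word_eq_refl.
- exact: word_eq_sym.
- exact: word_eq_trans IH1 IH2.
- rewrite -!catA !(catA p); exact: word_eq_cancel.
- rewrite -!catA !(catA p); exact: word_eq_relator.
Qed.

Lemma word_eq_cat u1 u2 v1 v2 :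
  word_eq u1 u2 -> word_eq v1 v2 -> word_eq (u1 ++ v1) (u2 ++ v2).
Proof.
move=> hu hv; apply: (@word_eq_trans _ (u2 ++ v1)).
  exact: (word_eq_cat2 [::] v1 hu).
by have := word_eq_cat2 u2 [::] hv; rewrite !cats0.
Qed.

Lemma word_inv_cons x w : word_inv (x :: w) = word_inv w ++ [:: (x.1, ~~ x.2)].
Proof. by rewrite /word_inv /= rev_cons cats1. Qed.

Lemma word_invK : involutive word_inv.
Proof.
move=> w; rewrite /word_inv map_rev revK -map_comp -[RHS]map_id.
by apply: eq_map => -[i b] /=; rewrite negbK.
Qed.

Lemma word_mulV w : word_eq (w ++ word_inv w) [::].
Proof.
elim: w => [|[i b] w IH]; first exact: word_eq_refl.
rewrite word_inv_cons /=; apply: word_eq_trans (word_eq_cancel [::] [::] i b).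
by have := word_eq_cat2 [:: (i, b)] [:: (i, ~~ b)] IH; rewrite /= -catA.
Qed.

Lemma word_mulV_l w : word_eq (word_inv w ++ w) [::].
Proof. by have := word_mulV (word_inv w); rewrite word_invK. Qed.

Lemma word_eq_inv w1 w2 : word_eq w1 w2 -> word_eq (word_inv w1) (word_inv w2).
Proof.
move=> h; apply: (@word_eq_trans _ (word_inv w1 ++ (w2 ++ word_inv w2))).
  rewrite -{1}[word_inv w1]cats0; apply: word_eq_cat; first exact: word_eq_refl.
  exact/word_eq_sym/word_mulV.
rewrite catA -[X in word_eq _ X]cat0s; apply: word_eq_cat; last exact: word_eq_refl.
apply: word_eq_trans (word_mulV_l w1); apply: word_eq_cat; first exact: word_eq_refl.
exact: word_eq_sym.
Qed.

Lemma pi1P w1 w2 : reflect (\pi_pi1 w1 = \pi_pi1 w2) `[< word_eq w1 w2 >].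
Proof. by apply: (iffP idP) => [|] /(eqmodP word_eqb_equiv). Qed.

Definition pi1_one : pi1 := \pi_pi1 [::].
Definition pi1_mul (g h : pi1) : pi1 := \pi_pi1 (repr g ++ repr h).
Definition pi1_inv (g : pi1) : pi1 := \pi_pi1 (word_inv (repr g)).

Lemma repr_pi1 w : word_eq (repr (\pi_pi1 w)) w.
Proof. by apply/asboolP/pi1P; rewrite reprK. Qed.

Lemma pi1_mulE w1 w2 : pi1_mul (\pi_pi1 w1) (\pi_pi1 w2) = \pi_pi1 (w1 ++ w2).
Proof. by apply/pi1P/asboolP/word_eq_cat; apply: repr_pi1. Qed.

Lemma pi1_invE w : pi1_inv (\pi_pi1 w) = \pi_pi1 (word_inv w).
Proof. by apply/pi1P/asboolP/word_eq_inv; apply: repr_pi1. Qed.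

Lemma pi1W (P : pi1 -> Prop) : (forall w, P (\pi_pi1 w)) -> forall g, P g.
Proof. by move=> Pw g; rewrite -[g]reprK; apply: Pw. Qed.

Lemma pi1_mulA : associative pi1_mul.
Proof.
elim/pi1W => u; elim/pi1W => v; elim/pi1W => w.
by rewrite !pi1_mulE catA.
Qed.

Lemma pi1_mul1 : left_id pi1_one pi1_mul.
Proof. by elim/pi1W => u; rewrite pi1_mulE. Qed.

Lemma pi1_mulr1 : right_id pi1_one pi1_mul.
Proof. by elim/pi1W => u; rewrite pi1_mulE cats0. Qed.

Lemma pi1_mulVl : left_inverse pi1_one pi1_inv pi1_mul.
Proof.
by elim/pi1W => u; rewrite pi1_invE pi1_mulE; apply/pi1P/asboolP/word_mulV_l.
Qed.

Lemma pi1_mulVr : right_inverse pi1_one pi1_inv pi1_mul.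
Proof.
by elim/pi1W => u; rewrite pi1_invE pi1_mulE; apply/pi1P/asboolP/word_mulV.
Qed.

HB.instance Definition _ := isGroup.Build pi1
  pi1_mulA pi1_mul1 pi1_mulr1 pi1_mulVl pi1_mulVr.

Definition loop (i : 'I_4) : pi1 := \pi_pi1 [:: (i, false)].
Notation loopA := (loop 0).
Notation loopB := (loop 1).
Notation loopC := (loop 2).
Notation loopD := (loop 3).

Lemma loop_rel : (loopA * loopB * loopC * loopD)%g = 1%g.
Proof.
have mulE w1 w2 : (\pi_pi1 w1 * \pi_pi1 w2)%g = \pi_pi1 (w1 ++ w2).
  exact: pi1_mulE.
rewrite /loop !mulE; apply/pi1P/asboolP.
exact: (word_eq_relator [::] [::]).
Qed.

(* The mapping class group of the four-punctured sphere, through the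
   Dehn-Nielsen-Baer theorem: automorphisms permuting the conjugacy classes of
   the positively oriented peripheral loops (so punctures may be permuted and
   orientation is preserved). Inner automorphisms are not divided out; they act
   trivially on characters. *)
Definition mapping_class (phi : {multiplicative pi1 -> pi1}) : Prop :=
  bijective phi /\
  exists s : 'S_4, forall i, exists g, phi (loop i) = (loop (s i) ^ g)%g.

Section CharacterVariety.
Variable R : realType.

Definition SL2_rep (rho : pi1 -> 'M[R]_2) : Prop :=
  (forall g h, rho (g * h)%g = rho g *m rho h) /\ (forall g, \det (rho g) = 1).

(* rho has all boundary traces equal to 2, and its character is the point p
   in the coordinates (X, Y, Z). *)
Definition has_character (rho : pi1 -> 'M[R]_2) (p : R * R * R) : Prop :=
  [/\ SL2_rep rho, (forall i, \tr (rho (loop i)) = 2) &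
      p = (\tr (rho (loopA * loopB)%g), \tr (rho (loopB * loopC)%g),
           \tr (rho (loopC * loopA)%g))].

Definition V2 : set (R * R * R) := [set p | let: (X, Y, Z) := p in
  X ^+ 2 + Y ^+ 2 + Z ^+ 2 + X * Y * Z - 8 * X - 8 * Y - 8 * Z + 28 = 0].

Definition teichmuller : set (R * R * R) :=
  V2 `&` [set p | let: (X, Y, Z) := p in [/\ X < -2, Y < -2 & Z < -2]].

(* A point of the Teichmuller component is the character of a representation
   into SL_2(R), so real representations suffice to describe the action. *)
Definition mcg_orbit (p : R * R * R) : set (R * R * R) :=
  [set q | exists phi : {multiplicative pi1 -> pi1}, mapping_class phi /\
     exists rho, has_character rho p /\ has_character (rho \o phi) q].

Definition trace_field (p : R * R * R) : set R :=
  smallest (fun F : set R => divring_closed (mem F))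
    [set t | exists rho g, has_character rho p /\ t = \tr (rho g)].

End CharacterVariety.

(* Finite places of a number field, as normalized discrete valuations. The
   value at 0 (which should be +oo) is pinned to 0, so that a place is
   determined by its values on nonzero elements and 0 is S-integral below. *)
Record finite_place (K : fieldType) := FinitePlace {
  val_at :> K -> int;
  val_at0 : val_at 0 = 0;
  val_atM : forall x y, x != 0 -> y != 0 -> val_at (x * y) = val_at x + val_at y;
  val_atD : forall x y, x != 0 -> y != 0 -> x + y != 0 ->
    Num.min (val_at x) (val_at y) <= val_at (x + y);
  val_at_normalized : exists x, val_at x = 1
}.

Definition S_integers (K : fieldType) (S : set (finite_place K)) : set K :=
  [set x | forall v : finite_place K, ~ S v -> 0 <= v x].

Definition S_integral_points (R : realType) (K : fieldType)
    (iota : {rmorphism K -> R}) (S : set (finite_place K)) : set (R * R * R) :=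
  [set p | exists x y z, [/\ S_integers S x, S_integers S y, S_integers S z &
                             p = (iota x, iota y, iota z)]].

(* Main.v *)
From HB Require Import structures.
Require Import Defs.
From mathcomp Require Import all_boot all_order all_algebra perm fieldext falgebra.
From mathcomp Require Import all_classical all_reals.
From mathcomp Require Import ring lra zify.
Import Order.TTheory GRing.Theory Num.Theory.
Local Open Scope classical_set_scope.
Local Open Scope quotient_scope.
Local Open Scope ring_scope.

Set Implicit Arguments.
Unset Strict Implicit.
Unset Printing Implicit Defensive.

(** With x = 2 - X, y = 2 - Y, z = 2 - Z the surface becomes
    (x + y + z)^2 = x y z, and the Teichmuller component is the part with
    x, y, z > 0. Off X = 2 a representation is determined by its character up
    to conjugation, so orbits are equivalence classes.

    Over the integers, the half twists act by Vieta involutions, and Markov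
    descent brings every point into a bounded box.

    In the other cases the points x = y = (2 + g)^2 / g, z = (2 + g)^2, for
    positive units g generating K, give infinitely many orbits. An orbit
    invariant is the set of traces of the representation, which has entries in
    Z[g, 1/g]. If K = Q and p is inverted by S, take g = p^-n: the
    representation is trivial modulo 2 + g, so x, y, z are divisible by
    (2 + g)^2 along the orbit. If K <> Q, take units g = 1 modulo m: the traces
    lie in Z + m O, and only points with rational coordinates have their
    coordinates there for arbitrarily large m.

    Such units come from a pigeonhole argument: there are x in O with
    coefficients at most T and real embedding of size T^(1-d), hence with
    bounded norm, and two of them congruent modulo a suitable integer have a
    unit as quotient. If that unit generated a proper subfield, its real
    embedding would be at least a double eigenvalue of the multiplication
    matrix and its norm would be smaller than 1 for T large. *)

(** * Words and 2x2 matrices *)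

Definition letter (x : 'I_4 * bool) : pi1 :=
  if x.2 then ((loop x.1)^-1)%g else loop x.1.

Lemma pi1_consE x w : (\pi_pi1 (x :: w) = letter x * \pi_pi1 w)%g.
Proof.
have mulE w1 w2 : (\pi_pi1 w1 * \pi_pi1 w2)%g = \pi_pi1 (w1 ++ w2).
  exact: pi1_mulE.
have invE w1 : ((\pi_pi1 w1)^-1)%g = \pi_pi1 (word_inv w1) by exact: pi1_invE.
by case: x => i [] /=; rewrite /letter /loop /= ?invE mulE.
Qed.

Lemma pi1_ind (P : pi1 -> Prop) :
  P 1%g -> (forall x g, P g -> P (letter x * g)%g) -> forall g, P g.
Proof.
move=> P1 PM; elim/pi1W; elim=> [|x w IH]; first exact: P1.
by rewrite pi1_consE; apply: PM.
Qed.

Lemma ord4P (P : 'I_4 -> Prop) : P 0 -> P 1 -> P 2 -> P 3 -> forall i, P i.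
Proof.
move=> P0 P1 P2 P3 [[|[|[|[|i]]]] Hi] //.
- by rewrite (_ : Ordinal Hi = 0) //; apply: val_inj.
- by rewrite (_ : Ordinal Hi = 1) //; apply: val_inj.
- by rewrite (_ : Ordinal Hi = 2) //; apply: val_inj.
- by rewrite (_ : Ordinal Hi = 3) //; apply: val_inj.
Qed.

Section Lift.
Variables (T : Type) (op : T -> T -> T) (e : T) (f : 'I_4 * bool -> T).
Hypotheses (opA : associative op) (op1l : left_id e op) (op1r : right_id e op).
Hypothesis fV : forall i b, op (f (i, b)) (f (i, ~~ b)) = e.
Hypothesis frel : op (op (op (f (0, false)) (f (1, false))) (f (2, false)))
  (f (3, false)) = e.

Definition lift_word (w : word) : T := foldr (fun x => op (f x)) e w.

Lemma lift_word_cat u v : lift_word (u ++ v) = op (lift_word u) (lift_word v).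
Proof. by elim: u => [|x u IH] /=; rewrite ?op1l // IH opA. Qed.

Lemma lift_word_eq u v : word_eq u v -> lift_word u = lift_word v.
Proof.
elim=> {u v} [//|u v _ -> //|u v w _ -> _ -> //|u v i b|u v].
  by rewrite !lift_word_cat /= op1r fV op1l.
have Hr : lift_word relator = e by rewrite /lift_word /relator /= op1r !opA.
by rewrite !lift_word_cat Hr op1l.
Qed.

(** Universal property of the presentation, for an arbitrary monoid: it yields matrix
    representations as well as endomorphisms of [pi1]. *)
Definition pi1_lift (g : pi1) : T := lift_word (repr g).

Lemma pi1_lift1 : pi1_lift 1%g = e.
Proof. exact: (lift_word_eq (repr_pi1 [::])). Qed.

Lemma pi1_liftM g h : pi1_lift (g * h)%g = op (pi1_lift g) (pi1_lift h).
Proof.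
rewrite -lift_word_cat; exact: (lift_word_eq (repr_pi1 (repr g ++ repr h))).
Qed.

Lemma pi1_lift_letter x : pi1_lift (letter x) = f x.
Proof.
have H : letter x = \pi_pi1 [:: x].
  by rewrite pi1_consE (_ : \pi_pi1 [::] = 1%g) // mulg1.
by rewrite H /pi1_lift (lift_word_eq (repr_pi1 [:: x])) /= op1r.
Qed.

End Lift.

Section Matrix2.
Variable F : comPzRingType.

Definition mx2 (a b c d : F) : 'M[F]_2 :=
  \matrix_(i, j) if i == 0 then (if j == 0 then a else b)
                 else (if j == 0 then c else d).

Lemma ord2P (P : 'I_2 -> Prop) : P 0 -> P 1 -> forall i, P i.
Proof.
move=> P0 P1 [[|[|i]] Hi] //.
- by rewrite (_ : Ordinal Hi = 0) //; apply: val_inj.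
- by rewrite (_ : Ordinal Hi = 1) //; apply: val_inj.
Qed.

Lemma mx2_eta (M : 'M[F]_2) : M = mx2 (M 0 0) (M 0 1) (M 1 0) (M 1 1).
Proof. by apply/matrixP; apply: ord2P; apply: ord2P; rewrite mxE. Qed.

Lemma mx2P (M N : 'M[F]_2) : M 0 0 = N 0 0 -> M 0 1 = N 0 1 ->
  M 1 0 = N 1 0 -> M 1 1 = N 1 1 -> M = N.
Proof.
by move=> h1 h2 h3 h4; rewrite (mx2_eta M) (mx2_eta N) h1 h2 h3 h4.
Qed.

Lemma mx2M a b c d a' b' c' d' : mx2 a b c d *m mx2 a' b' c' d' =
  mx2 (a * a' + b * c') (a * b' + b * d') (c * a' + d * c') (c * b' + d * d').
Proof. by apply: mx2P; rewrite !mxE !big_ord_recl big_ord0 !mxE /= addr0. Qed.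

Lemma mx2_tr a b c d : \tr (mx2 a b c d) = a + d.
Proof. by rewrite /mxtrace !big_ord_recl big_ord0 !mxE /= addr0. Qed.

Lemma mx2_det a b c d : \det (mx2 a b c d) = a * d - b * c.
Proof. rewrite (expand_det_row _ 0) !big_ord_recl big_ord0 /cofactor !det_mx11 !mxE /=.
by rewrite expr0 expr1; ring. Qed.

Lemma mx2_1 : 1%:M = mx2 1 0 0 1.
Proof. by apply: mx2P; rewrite !mxE. Qed.

End Matrix2.

Lemma mx2_inv (F : fieldType) (a b c d : F) :
  \det (mx2 a b c d) = 1 -> invmx (mx2 a b c d) = mx2 d (- b) (- c) a.
Proof.
move=> h; have U : mx2 a b c d \in unitmx by rewrite unitmxE h unitr1.
apply: (can_inj (mulKmx U)); rewrite mulmxV // mx2M mx2_1 -h mx2_det.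
by apply/esym; congr mx2; ring.
Qed.

Lemma mx2_tr_inv (F : fieldType) (M : 'M[F]_2) :
  \det M = 1 -> \tr (invmx M) = \tr M.
Proof. by rewrite (mx2_eta M) => /mx2_inv ->; rewrite !mx2_tr addrC. Qed.

(** Certificate form of a consequence: [k] is the multiplier of the known equation, and [ring] or
    [field] checks the resulting identity. *)
Lemma eq_combination (F : pzRingType) (k x y a b : F) :
  x = y -> a - b = k * (x - y) -> a = b.
Proof. by move=> -> H; apply/eqP; rewrite -subr_eq0 H subrr mulr0. Qed.

(* With N_A = A - 1 and N_B = B - 1 nilpotent of rank one, the basis is
   (N_A w, w) for a column w of N_B. *)
Lemma parabolic_pair (F : fieldType) (A B : 'M[F]_2) (x : F) :
  \det A = 1 -> \det B = 1 -> \tr A = 2 -> \tr B = 2 -> \tr (A *m B) = x ->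
  x != 2 -> exists P, [/\ P \in unitmx, A *m P = P *m mx2 1 1 0 1 &
                          B *m P = P *m mx2 1 0 (x - 2) 1].
Proof.
rewrite (mx2_eta A) (mx2_eta B).
move: (A 0 0) (A 0 1) (A 1 0) (A 1 1) (B 0 0) (B 0 1) (B 1 0) (B 1 1).
move=> {A B} a b c d e f g h.
rewrite mx2M !mx2_det !mx2_tr => detA detB trA trB <- x2.
have Ed : d = 2 - a by rewrite -trA; ring.
have Eh : h = 2 - e by rewrite -trB; ring.
rewrite {trA trB}Ed Eh in detA detB x2 *.
have u0 : a * e + b * g + (c * f + (2 - a) * (2 - e)) - 2 != 0 by rewrite subr_eq0.
set u := _ - 2 in u0 *.
(* It remains to find a column w with N_B w = 0 and N_B N_A w = u w such that N_A w and w are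
   independent. *)
have Q w1 w2 : (e - 1) * w1 + f * w2 = 0 -> g * w1 + (1 - e) * w2 = 0 ->
    (e - 1) * ((a - 1) * w1 + b * w2) + f * (c * w1 + (1 - a) * w2) = u * w1 ->
    g * ((a - 1) * w1 + b * w2) + (1 - e) * (c * w1 + (1 - a) * w2) = u * w2 ->
    ((a - 1) * w1 + b * w2) * w2 - w1 * (c * w1 + (1 - a) * w2) != 0 ->
  exists P, [/\ P \in unitmx, mx2 a b c (2 - a) *m P = P *m mx2 1 1 0 1 &
                          mx2 e f g (2 - e) *m P = P *m mx2 1 0 u 1].
  move=> h1 h2 h3 h4 k0.
  exists (mx2 ((a - 1) * w1 + b * w2) w1 (c * w1 + (1 - a) * w2) w2); split.
  - by rewrite unitmxE mx2_det unitfE.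
  - rewrite !mx2M; congr mx2.
    + by apply: (eq_combination (k := - w1) detA); ring.
    + by ring.
    + by apply: (eq_combination (k := - w2) detA); ring.
    + by ring.
  - rewrite !mx2M; congr mx2.
    + by apply: (eq_combination (k := 1) h3); ring.
    + by apply: (eq_combination (k := 1) h1); ring.
    + by apply: (eq_combination (k := 1) h4); ring.
    + by apply: (eq_combination (k := 1) h2); ring.
(* Since N_B squares to 0, its columns lie in its kernel. The first column works if [g != 0];
   otherwise the second does, because [f = 0] would give B = 1 and [u = 0]. *)
have [g0|g0] := eqVneq g 0; last first.
  apply: (Q (e - 1) g).
  - by apply: (eq_combination (k := -1) detB); ring.
  - by ring.
  - by apply: (eq_combination (k := a - 1) detB); rewrite /u; ring.
  - by apply: (eq_combination (k := c) detB); rewrite /u; ring.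
  - suff -> : ((a - 1) * (e - 1) + b * g) * g - (e - 1) * (c * (e - 1) + (1 - a) * g)
      = g * u by rewrite mulf_neq0.
    by apply: (eq_combination (k := c) detB); rewrite /u; ring.
apply: (Q f (1 - e)).
- by ring.
- by apply: (eq_combination (k := -1) detB); ring.
- by apply: (eq_combination (k := b) detB); rewrite /u; ring.
- by apply: (eq_combination (k := 1 - a) detB); rewrite /u; ring.
- suff -> : ((a - 1) * f + b * (1 - e)) * (1 - e) - f * (c * f + (1 - a) * (1 - e))
    = - (f * u).
    rewrite oppr_eq0 mulf_neq0 //; apply: contraNneq u0 => f0.
    have e1 : (e - 1) ^+ 2 = 0.
      by apply: (eq_combination (k := -1) detB); rewrite f0; ring.
    move: e1 => /eqP; rewrite expf_eq0 /= => /eqP e1.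
    have {}e1 : e = 1 by apply/eqP; rewrite -subr_eq0 e1.
    by rewrite /u f0 g0 e1; apply/eqP; ring.
  by apply: (eq_combination (k := - b) detB); rewrite /u; ring.
Qed.

(** In the basis that normalizes A and B, the traces of C, BC, CA and ABC are four linear equations
    in the entries of C, uniquely solvable because [x != 2]. *)
Lemma SL2_triple_normal_form (F : fieldType) (A B C : 'M[F]_2) (x y z : F) :
  [/\ \det A = 1, \det B = 1 & \det C = 1] ->
  [/\ \tr A = 2, \tr B = 2, \tr C = 2 & \tr (A *m B *m C) = 2] ->
  [/\ \tr (A *m B) = x, \tr (B *m C) = y & \tr (C *m A) = z] -> x != 2 ->
  exists P, [/\ P \in unitmx, A *m P = P *m mx2 1 1 0 1,
    B *m P = P *m mx2 1 0 (x - 2) 1 &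
    C *m P = P *m mx2 (- (y + z - 4) / (x - 2)) ((y - 2) / (x - 2))
                      (z - 2) (2 + (y + z - 4) / (x - 2))].
Proof.
move=> [dA dB dC] [tA tB tC tABC] [tAB tBC tCA] x2.
have [P [Pu hA hB]] := parabolic_pair dA dB tA tB tAB x2.
exists P; split=> //.
have trP (M N : 'M[F]_2) : M *m P = P *m N -> \tr M = \tr N.
  by move=> h; rewrite -(mulmxK Pu M) h mxtrace_mulC mulmxA mulVmx // mul1mx.
have PM (M N M' N' : 'M[F]_2) : M *m P = P *m N -> M' *m P = P *m N' ->
    (M *m M') *m P = P *m (N *m N').
  by move=> h h'; rewrite -mulmxA h' !mulmxA h.
have hC : C *m P = P *m (invmx P *m C *m P) by rewrite !mulmxA mulmxV // mul1mx.
rewrite hC; congr (_ *m _); move: (invmx P *m C *m P) hC => D hC.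
move: (trP _ _ hC) (trP _ _ (PM _ _ _ _ hB hC)) (trP _ _ (PM _ _ _ _ hC hA))
  (trP _ _ (PM _ _ _ _ (PM _ _ _ _ hA hB) hC)).
rewrite tC tBC tCA tABC (mx2_eta D).
move: (D 0 0) (D 0 1) (D 1 0) (D 1 1) => p q r s.
rewrite !mx2M !mx2_tr => h1 h2 h3 h4.
have u0 : x - 2 != 0 by rewrite subr_eq0.
have es : s = 2 - p by rewrite h1; ring.
have er : r = z - 2 by rewrite h3 h1; ring.
have eq : q = (y - 2) / (x - 2).
  by apply: (mulIf u0); rewrite mulfVK // h2 h1; ring.
have ep : p = - (y + z - 4) / (x - 2).
  apply: (mulIf u0); rewrite mulfVK //.
  apply: (eq_combination (k := -1) h4).
  by rewrite es er h2 es; ring.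
by rewrite es er eq ep mulNr opprK.
Qed.

(** * Representations and rigidity *)

Section Representations.
Variable F : fieldType.
Implicit Types (rho sigma : pi1 -> 'M[F]_2) (A B C P : 'M[F]_2).

(* [SL2_rep] over an arbitrary field *)
Definition mxrep rho : Prop :=
  (forall g h, rho (g * h)%g = rho g *m rho h) /\ (forall g, \det (rho g) = 1).

Lemma mxrep_unit rho g : mxrep rho -> rho g \in unitmx.
Proof. by case=> _ h; rewrite unitmxE h unitr1. Qed.

Lemma mxrep1 rho : mxrep rho -> rho 1%g = 1%:M.
Proof.
move=> hr; have U := mxrep_unit 1%g hr.
by apply: (can_inj (mulKmx U)); rewrite -hr.1 mulg1 mulmx1.
Qed.

Lemma mxrepV rho g : mxrep rho -> rho (g^-1)%g = invmx (rho g).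
Proof.
move=> hr; have U := mxrep_unit g hr.
by apply: (can_inj (mulKmx U)); rewrite -hr.1 mulgV mulmxV // mxrep1.
Qed.

Lemma mxrep_conj rho sigma P : mxrep rho -> mxrep sigma ->
  (forall i, rho (loop i) *m P = P *m sigma (loop i)) ->
  forall g, rho g *m P = P *m sigma g.
Proof.
move=> hr hs hP; apply: pi1_ind => [|[i b] g IH].
  by rewrite !mxrep1 // mul1mx mulmx1.
rewrite hr.1 hs.1 -mulmxA IH !mulmxA; congr (_ *m _).
rewrite /letter; case: b => /=; last exact: hP.
have [Ur Us] := (mxrep_unit (loop i) hr, mxrep_unit (loop i) hs).
rewrite !mxrepV //; apply: (can_inj (mulKmx Ur)); apply: (can_inj (mulmxK Us)).
by rewrite !mulmxA mulmxV // mul1mx -hP mulmxKV // hP.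
Qed.

Definition triple_gen A B C (i : 'I_4) : 'M[F]_2 :=
  nth 0 [:: A; B; C; invmx (A *m B *m C)] i.

Definition triple_rep A B C : pi1 -> 'M[F]_2 :=
  pi1_lift mulmx 1%:M (fun x : 'I_4 * bool =>
    if x.2 then invmx (triple_gen A B C x.1) else triple_gen A B C x.1).

Section Triple.
Variables A B C : 'M[F]_2.
Hypotheses (dA : \det A = 1) (dB : \det B = 1) (dC : \det C = 1).

Lemma triple_gen_det i : \det (triple_gen A B C i) = 1.
Proof.
elim/ord4P: i => //; rewrite /triple_gen /= det_inv !det_mulmx dA dB dC.
by rewrite !mulr1 invr1.
Qed.

Let unit_gen i : triple_gen A B C i \in unitmx.
Proof. by rewrite unitmxE triple_gen_det unitr1. Qed.

Let lift_side : (forall i b,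
    (if b then invmx (triple_gen A B C i) else triple_gen A B C i) *m
    (if ~~ b then invmx (triple_gen A B C i) else triple_gen A B C i) = 1%:M) /\
  A *m B *m C *m invmx (A *m B *m C) = 1%:M.
Proof.
split=> [i []|] /=; rewrite ?mulmxV ?mulVmx //.
by rewrite unitmxE !det_mulmx dA dB dC !mulr1 unitr1.
Qed.

Lemma triple_repE x : triple_rep A B C (letter x) =
  if x.2 then invmx (triple_gen A B C x.1) else triple_gen A B C x.1.
Proof.
apply: pi1_lift_letter; [exact: mulmxA|exact: mul1mx|exact: mulmx1| |].
  exact: lift_side.1.
exact: lift_side.2.
Qed.

Lemma triple_rep_loop i : triple_rep A B C (loop i) = triple_gen A B C i.
Proof. exact: (triple_repE (i, false)). Qed.

Lemma triple_rep1 : triple_rep A B C 1%g = 1%:M.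
Proof.
apply: pi1_lift1; [exact: mulmxA|exact: mul1mx|exact: mulmx1| |].
  exact: lift_side.1.
exact: lift_side.2.
Qed.

Lemma triple_repM g h :
  triple_rep A B C (g * h)%g = triple_rep A B C g *m triple_rep A B C h.
Proof.
apply: pi1_liftM; [exact: mulmxA|exact: mul1mx|exact: mulmx1| |].
  exact: lift_side.1.
exact: lift_side.2.
Qed.

Lemma triple_rep_mxrep : mxrep (triple_rep A B C).
Proof.
split; first exact: triple_repM.
apply: pi1_ind => [|[i b] g IH]; first by rewrite triple_rep1 det1.
rewrite triple_repM det_mulmx IH mulr1 triple_repE /=.
by case: b; rewrite ?det_inv triple_gen_det ?invr1.
Qed.

Lemma triple_rep_tr :
  [/\ \tr A = 2, \tr B = 2, \tr C = 2 & \tr (A *m B *m C) = 2] ->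
  forall i, \tr (triple_rep A B C (loop i)) = 2.
Proof.
case=> tA tB tC tABC; apply: ord4P; rewrite triple_rep_loop /triple_gen //=.
by rewrite mx2_tr_inv // !det_mulmx dA dB dC !mulr1.
Qed.

End Triple.
End Representations.

Section Characters.
Variable R : realType.
Implicit Types (rho sigma : pi1 -> 'M[R]_2) (p q : R * R * R).

(** The normal form with parameters [p] is itself a representation: up to the factor -(X - 2)^-2,
    the condition det C = 1 is the equation of [V2]. *)
Lemma has_character_exists p : V2 p -> p.1.1 != 2 -> exists rho, has_character rho p.
Proof.
case: p => [[x y] z] /= V x2; have u0 : x - 2 != 0 by rewrite subr_eq0.
pose A : 'M[R]_2 := mx2 1 1 0 1; pose B : 'M[R]_2 := mx2 1 0 (x - 2) 1.
pose C : 'M[R]_2 := mx2 (- (y + z - 4) / (x - 2)) ((y - 2) / (x - 2))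
                      (z - 2) (2 + (y + z - 4) / (x - 2)).
have dA : \det A = 1 by rewrite mx2_det; ring.
have dB : \det B = 1 by rewrite mx2_det; ring.
have dC : \det C = 1.
  rewrite mx2_det; apply: (eq_combination (k := - (x - 2)^-2) V).
  by field.
exists (triple_rep A B C); split.
- exact: triple_rep_mxrep.
- by apply: triple_rep_tr => //; rewrite !mx2M !mx2_tr; split; try ring; field.
- have [_ M] := triple_rep_mxrep dA dB dC.
  rewrite !triple_repM // !triple_rep_loop // /triple_gen /= !mx2M !mx2_tr.
  by congr (_, _, _); [ring|field|ring].
Qed.

Lemma has_character_normal_form rho p : has_character rho p -> p.1.1 != 2 ->
  exists P, [/\ P \in unitmx, rho loopA *m P = P *m mx2 1 1 0 1,
    rho loopB *m P = P *m mx2 1 0 (p.1.1 - 2) 1 &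
    rho loopC *m P = P *m mx2 (- (p.1.2 + p.2 - 4) / (p.1.1 - 2))
      ((p.1.2 - 2) / (p.1.1 - 2)) (p.2 - 2) (2 + (p.1.2 + p.2 - 4) / (p.1.1 - 2))].
Proof.
case=> hr ht hp p2; apply: SL2_triple_normal_form => //; try by split; apply: hr.2.
- split; rewrite ?ht // -!hr.1.
  (* The loop D is inverse to ABC, and inverse elements of SL_2 have equal traces, so the fourth
     boundary trace gives tr ABC = 2. *)
  have <- : \tr (rho (loopD)^-1)%g = 2 by rewrite mxrepV // mx2_tr_inv ?ht ?hr.2.
  by congr (\tr (rho _)); apply: (mulIg loopD); rewrite loop_rel mulVg.
- by rewrite hp -!hr.1.
Qed.

Lemma loopDE : loopD = ((loopA * loopB * loopC)^-1)%g.
Proof. by apply: (mulgI (loopA * loopB * loopC)%g); rewrite loop_rel mulgV. Qed.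

(** Both representations are conjugate to the same normal form, which depends on [p] alone, hence to
    each other. *)
Lemma character_rigid rho sigma p :
  has_character rho p -> has_character sigma p -> p.1.1 != 2 ->
  forall g, \tr (rho g) = \tr (sigma g).
Proof.
move=> hr hs p2.
have [P [uP Pa Pb Pc]] := has_character_normal_form hr p2.
have [Q [uQ Qa Qb Qc]] := has_character_normal_form hs p2.
move: hr hs => [hr _ _] [hs _ _].
have conjPQ (M N L : 'M[R]_2) : M *m P = P *m L -> N *m Q = Q *m L ->
    M *m (P *m invmx Q) = (P *m invmx Q) *m N.
  move=> h1 h2; apply: (can_inj (mulmxK uQ)).
  by rewrite !mulmxA h1 mulmxKV // -mulmxA h2 mulmxA mulmxKV.
have hA := conjPQ _ _ _ Pa Qa; have hB := conjPQ _ _ _ Pb Qb.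
have hC := conjPQ _ _ _ Pc Qc; set U := P *m invmx Q in hA hB hC.
have uU : U \in unitmx by rewrite unitmx_mul uP unitmx_inv.
clearbody U.
have H : forall g, rho g *m U = U *m sigma g.
  apply: mxrep_conj => //; apply: ord4P => //.
  rewrite loopDE !mxrepV //.
  have hABC : rho (loopA * loopB * loopC)%g *m U = U *m sigma (loopA * loopB * loopC)%g.
    rewrite !hr.1 !hs.1 -[LHS]mulmxA hC -[LHS]mulmxA [rho loopB *m _]mulmxA hB.
    by rewrite !mulmxA hA.
  have [Ur Us] := (mxrep_unit (loopA * loopB * loopC)%g hr,
                   mxrep_unit (loopA * loopB * loopC)%g hs).
  apply: (can_inj (mulKmx Ur)); apply: (can_inj (mulmxK Us)).
  by rewrite !mulmxA mulmxV // mul1mx -hABC mulmxKV // hABC.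
move=> g; rewrite -(mulmxK uU (rho g)) H mxtrace_mulC mulmxA mulVmx // mul1mx //.
Qed.

End Characters.

(** * Mapping class group orbits *)

Lemma pi1_map1 (phi : {multiplicative pi1 -> pi1}) : phi 1%g = 1%g.
Proof. by apply: (mulgI (phi 1%g)); rewrite -gmulfM !mulg1. Qed.

Lemma pi1_mapV (phi : {multiplicative pi1 -> pi1}) g :
  phi (g^-1)%g = ((phi g)^-1)%g.
Proof. by apply: (mulgI (phi g)); rewrite -gmulfM !mulgV pi1_map1. Qed.

Lemma pi1_mapJ (phi : {multiplicative pi1 -> pi1}) g h :
  phi (g ^ h)%g = (phi g ^ phi h)%g.
Proof. by rewrite !conjgE !gmulfM pi1_mapV. Qed.

Lemma pi1_endo_exists (f : 'I_4 -> pi1) : (f 0 * f 1%R * f 2 * f 3 = 1)%g ->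
  exists phi : {multiplicative pi1 -> pi1}, forall i, phi (loop i) = f i.
Proof.
move=> hf; pose h (x : 'I_4 * bool) : pi1 := if x.2 then ((f x.1)^-1)%g else f x.1.
have hV i b : (h (i, b) * h (i, ~~ b) = 1)%g.
  by case: b; rewrite /h /= ?mulVg ?mulgV.
have M := @pi1_liftM pi1 *%g 1%g h (@mulgA pi1) (@mul1g pi1) (@mulg1 pi1) hV hf.
pose phi : {multiplicative pi1 -> pi1} :=
  HB.pack (pi1_lift *%g 1%g h) (isMultiplicative.Build _ _ (pi1_lift *%g 1%g h) M).
exists phi => i.
exact: (@pi1_lift_letter pi1 *%g 1%g h (@mulgA pi1) (@mul1g pi1) (@mulg1 pi1) hV hf (i, false)).
Qed.

Lemma pi1_endo_eq (phi psi : {multiplicative pi1 -> pi1}) :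
  (forall i, phi (loop i) = psi (loop i)) -> phi =1 psi.
Proof.
move=> h; apply: pi1_ind => [|[i b] g IH]; first by rewrite !pi1_map1.
rewrite !gmulfM IH /letter; case: b => /=; last by rewrite h.
by rewrite !pi1_mapV h.
Qed.

Lemma mapping_class_inv (phi : {multiplicative pi1 -> pi1}) : mapping_class phi ->
  exists psi : {multiplicative pi1 -> pi1}, mapping_class psi /\ cancel psi phi.
Proof.
move=> [[f fK Kf] [s hs]].
have fM : {morph f : x y / (x * y)%g}.
  by move=> x y; apply: (can_inj fK); rewrite gmulfM !Kf.
pose psi : {multiplicative pi1 -> pi1} := HB.pack f (isMultiplicative.Build _ _ f fM).
exists psi; split=> //; split; first by exists phi.
exists (s^-1)%g => i; have [g hg] := hs ((s^-1)%g i).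
exists ((f g)^-1)%g; apply: (can_inj fK).
by rewrite pi1_mapJ hg permKV pi1_mapV !Kf -conjgM mulgV conjg1.
Qed.

Lemma mapping_class_comp (phi psi : {multiplicative pi1 -> pi1}) :
  mapping_class phi -> mapping_class psi -> mapping_class (phi \o psi).
Proof.
move=> [bphi [s hs]] [bpsi [t ht]]; split; first exact: bij_comp.
exists (t * s)%g => i /=; have [g ->] := ht i; have [h hh] := hs (t i).
by exists (h * phi g)%g; rewrite pi1_mapJ hh permM conjgM.
Qed.

Lemma mapping_class_id : mapping_class idfun.
Proof.
split; first by exists id.
by exists 1%g => i; exists 1%g; rewrite perm1 conjg1.
Qed.

Section Orbits.
Variable R : realType.
Implicit Types (rho sigma : pi1 -> 'M[R]_2) (p q : R * R * R).

Lemma mxrep_trC rho g h : mxrep rho -> \tr (rho (g * h)%g) = \tr (rho (h * g)%g).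
Proof. by move=> hr; rewrite !hr.1 mxtrace_mulC. Qed.

Lemma mxrep_trJ rho g h : mxrep rho -> \tr (rho (g ^ h)%g) = \tr (rho g).
Proof. by move=> hr; rewrite conjgE mxrep_trC // mulgK. Qed.

(** Cayley-Hamilton in determinant 1: the inverse of [rho h] is its trace minus [rho h]. *)
Lemma mxrep_tr_div rho g h : mxrep rho ->
  \tr (rho (g * h^-1)%g) = \tr (rho g) * \tr (rho h) - \tr (rho (g * h)%g).
Proof.
move=> hr; rewrite hr.1 mxrepV // hr.1.
have -> : invmx (rho h) = (\tr (rho h))%:M - rho h.
  move: (hr.2 h); rewrite (mx2_eta (rho h)) => /mx2_inv ->; rewrite mx2_tr.
  by apply: mx2P; rewrite !mxE /= ?mulr1n ?mulr0n; ring.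
rewrite mulmxBr mxtraceD [X in _ + X]raddfN mul_mx_scalar mxtraceZ mulrC.
by [].
Qed.

Lemma has_character_comp rho p (phi : {multiplicative pi1 -> pi1}) :
  has_character rho p -> mapping_class phi ->
  has_character (rho \o phi) (\tr (rho (phi (loopA * loopB)%g)),
    \tr (rho (phi (loopB * loopC)%g)), \tr (rho (phi (loopC * loopA)%g))).
Proof.
move=> [hr ht _] [_ [s hs]]; split=> //.
- by split=> [g h|g] /=; rewrite ?gmulfM ?hr.1 ?hr.2.
- by move=> i /=; have [g ->] := hs i; rewrite mxrep_trJ.
Qed.

Lemma mcg_orbit_refl p : V2 p -> p.1.1 != 2 -> mcg_orbit p p.
Proof.
move=> Vp p2; have [rho hr] := has_character_exists Vp p2.
by exists idfun; split; [exact: mapping_class_id|exists rho].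
Qed.

(** [mcg_orbit] quantifies over a representation with the given character; rigidity allows any other
    one to take its place. *)
Lemma has_character_tr_eq rho sigma p q (phi : {multiplicative pi1 -> pi1}) :
  has_character rho q -> has_character sigma q -> q.1.1 != 2 ->
  has_character (rho \o phi) p -> has_character (sigma \o phi) p.
Proof.
move=> hr hs q2 [_ ht ->]; have E := character_rigid hr hs q2.
case: hs => hs _ _; split.
- by split=> [g h|g] /=; rewrite ?gmulfM ?hs.1 ?hs.2.
- by move=> i; rewrite /= -E ht.
- by rewrite /= !E.
Qed.

(** Off X = 2, lying in one orbit is an equivalence relation: symmetry inverts the mapping class,
    and transitivity matches the two representations of the middle point by rigidity. *)
Lemma mcg_orbit_eq p q : p.1.1 != 2 -> q.1.1 != 2 -> mcg_orbit p q ->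
  mcg_orbit p = mcg_orbit q.
Proof.
move=> p2 q2 [phi [mphi [rho [hp hq]]]].
have [psi [mpsi psiK]] := mapping_class_inv mphi.
have hp' : has_character ((rho \o phi) \o psi) p.
  suff -> : (rho \o phi) \o psi = rho by [].
  by apply: funext => g /=; rewrite psiK.
rewrite eqEsubset; split=> r [chi [mchi [sigma [hs hr]]]].
  exists (psi \o chi); split; first exact: mapping_class_comp.
  exists (rho \o phi); split=> //.
  exact: (has_character_tr_eq hs hp' p2 hr).
exists (phi \o chi); split; first exact: mapping_class_comp.
exists rho; split=> //.
exact: (has_character_tr_eq hs hq q2 hr).
Qed.

(** [f] describes the half twist exchanging the punctures [i] and [j], and [g] its inverse.
    Composing them on the loops proves bijectivity, and [tperm i j] records the effect on the
    peripheral classes. *)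
Lemma half_twist_exists (i j : 'I_4) (f g : 'I_4 -> pi1) : i != j ->
  (f 0 * f 1%R * f 2 * f 3 = 1)%g -> (g 0 * g 1%R * g 2 * g 3 = 1)%g ->
  (forall k, k != i -> k != j -> f k = loop k /\ g k = loop k) ->
  f i = (loop i * loop j * (loop i)^-1)%g -> f j = loop i ->
  g i = loop j -> g j = ((loop j)^-1 * loop i * loop j)%g ->
  exists phi : {multiplicative pi1 -> pi1},
    mapping_class phi /\ forall k, phi (loop k) = f k.
Proof.
move=> ij hf hg hfg fi fj gi gj.
have [phi hphi] := pi1_endo_exists hf; have [psi hpsi] := pi1_endo_exists hg.
exists phi; split=> //; split.
  exists psi => x.
    rewrite -[RHS]/(idfun x); apply: (pi1_endo_eq (phi := psi \o phi)) => k /=.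
    rewrite hphi; have [->|ki] := eqVneq k i.
      by rewrite fi !gmulfM pi1_mapV !hpsi gi gj !mulgA mulgV mul1g mulgK.
    have [->|kj] := eqVneq k j; first by rewrite fj hpsi gi.
    by have [-> gk] := hfg k ki kj; rewrite hpsi.
  rewrite -[RHS]/(idfun x); apply: (pi1_endo_eq (phi := phi \o psi)) => k /=.
  rewrite hpsi; have [->|ki] := eqVneq k i; first by rewrite gi hphi fj.
  have [->|kj] := eqVneq k j.
    by rewrite gj !gmulfM pi1_mapV !hphi fi fj !mulgA mulVg mul1g mulgVK.
  by have [fk ->] := hfg k ki kj; rewrite hphi.
exists (tperm i j) => k; rewrite hphi; case: tpermP => [->|->|/eqP ki /eqP kj].
- by exists (loop i)^-1%g; rewrite fi conjgE invgK mulgA.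
- by exists 1%g; rewrite fj conjg1.
- by exists 1%g; rewrite conjg1; have [-> _] := hfg k ki kj.
Qed.

(** The twist sends A to the conjugate of B by A, and B to A. It keeps X, and 8 - y - xz is the
    second root of the cubic viewed as a quadratic in Y. *)
Lemma mcg_half_twist_AB (x y z : R) : V2 (x, y, z) -> x != 2 ->
  mcg_orbit (x, y, z) (x, z, 8 - y - x * z).
Proof.
move=> V x2; have [rho hr] := has_character_exists (p := (x, y, z)) V x2.
pose f (k : 'I_4) : pi1 :=
  nth 1%g [:: loopA * loopB * loopA^-1; loopA; loopC; loopD]%g k.
pose g (k : 'I_4) : pi1 :=
  nth 1%g [:: loopB; loopB^-1 * loopA * loopB; loopC; loopD]%g k.
have [phi [mphi hphi]] : exists phi : {multiplicative pi1 -> pi1},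
    mapping_class phi /\ forall k, phi (loop k) = f k.
  apply: (half_twist_exists (i := 0) (j := 1) (g := g)) => //.
  - by rewrite /f /= mulgVK loop_rel.
  - by rewrite /g /= !mulgA mulgV mul1g loop_rel.
  - by apply: ord4P.
exists phi; split=> //; exists rho; split=> //.
have := has_character_comp hr mphi; rewrite !gmulfM !hphi /f /=.
case: hr => hr ht [tAB tBC tCA].
suff -> : (\tr (rho (loopA * loopB * loopA^-1 * loopA)%g),
  \tr (rho (loopA * loopC)%g),
  \tr (rho (loopC * (loopA * loopB * loopA^-1))%g)) = (x, z, 8 - y - x * z) by [].
congr (_, _, _); first by rewrite mulgVK.
  by rewrite mxrep_trC.
have hABC : \tr (rho (loopA * loopB * loopC)%g) = 2.
  by have := ht 3; rewrite loopDE mxrepV // mx2_tr_inv ?hr.2.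
rewrite !mulgA mxrep_tr_div // ht -{1}(mulgA loopC) mxrep_trC // hABC.
(* The element (CA)(BA)^-1 equals CB^-1; expanding its trace in both forms expresses tr(CABA)
   through x, y, z. *)
have := mxrep_tr_div (loopC * loopA)%g (loopB * loopA)%g hr.
rewrite invgM mulgA mulgK mxrep_tr_div // !ht mulgA -tCA (mxrep_trC loopB) //.
rewrite -tAB (mxrep_trC loopC) // -tBC => h.
by apply: (eq_combination (k := -1) h); ring.
Qed.

(** The same computation with B and C: Y is kept, and 8 - z - xy is the other root in Z. *)
Lemma mcg_half_twist_BC (x y z : R) : V2 (x, y, z) -> x != 2 ->
  mcg_orbit (x, y, z) (8 - z - x * y, y, x).
Proof.
move=> V x2; have [rho hr] := has_character_exists (p := (x, y, z)) V x2.
pose f (k : 'I_4) : pi1 :=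
  nth 1%g [:: loopA; loopB * loopC * loopB^-1; loopB; loopD]%g k.
pose g (k : 'I_4) : pi1 :=
  nth 1%g [:: loopA; loopC; loopC^-1 * loopB * loopC; loopD]%g k.
have [phi [mphi hphi]] : exists phi : {multiplicative pi1 -> pi1},
    mapping_class phi /\ forall k, phi (loop k) = f k.
  apply: (half_twist_exists (i := 1) (j := 2) (g := g)) => //.
  - by rewrite /f /= !mulgA mulgVK loop_rel.
  - by rewrite /g /= !mulgA mulgK loop_rel.
  - by apply: ord4P.
exists phi; split=> //; exists rho; split=> //.
have := has_character_comp hr mphi; rewrite !gmulfM !hphi /f /=.
case: hr => hr ht [tAB tBC tCA].
suff -> : (\tr (rho (loopA * (loopB * loopC * loopB^-1))%g),
  \tr (rho (loopB * loopC * loopB^-1 * loopB)%g),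
  \tr (rho (loopB * loopA)%g)) = (8 - z - x * y, y, x) by [].
congr (_, _, _); last by rewrite mxrep_trC.
  have hABC : \tr (rho (loopA * loopB * loopC)%g) = 2.
    by have := ht 3; rewrite loopDE mxrepV // mx2_tr_inv ?hr.2.
  rewrite !mulgA mxrep_tr_div // ht hABC.
  have := mxrep_tr_div (loopA * loopB)%g (loopC * loopB)%g hr.
  rewrite invgM mulgA mulgK mxrep_tr_div // !ht mulgA -tAB (mxrep_trC loopC) //.
  rewrite -tBC (mxrep_trC loopA) // -tCA => h.
  by apply: (eq_combination (k := -1) h); ring.
by rewrite mulgVK.
Qed.
End Orbits.

(** * The family of points attached to a unit *)

Section Entries.
Variable F : fieldType.
Implicit Types (A B C M N : 'M[F]_2).

Lemma triple_rep_ind (P : 'M[F]_2 -> Prop) A B C :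
  \det A = 1 -> \det B = 1 -> \det C = 1 -> P 1%:M ->
  (forall M N, P M -> P N -> P (M *m N)) ->
  (forall M, \det M = 1 -> P M -> P (invmx M)) ->
  P A -> P B -> P C -> forall g, P (triple_rep A B C g).
Proof.
move=> dA dB dC P1 PM PV PA PB PC.
have Pgen i : P (triple_gen A B C i).
  elim/ord4P: i => //; apply: PV; last by apply: (PM) => //; apply: PM.
  by rewrite !det_mulmx dA dB dC !mulr1.
apply: pi1_ind => [|[i b] g IH]; first by rewrite triple_rep1.
rewrite triple_repM //; apply: PM => //; rewrite triple_repE //=.
by case: b => //; apply: PV => //; apply: triple_gen_det.
Qed.

(** A bare predicate, so that valuation rings, Z[1/p], orders and subsets of the reals are treated
    alike. *)
Definition subring (L : F -> Prop) : Prop :=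
  [/\ L 1, forall x y, L x -> L y -> L (x - y) & forall x y, L x -> L y -> L (x * y)].

Section Subring.
Variable L : F -> Prop.
Hypothesis hL : subring L.

Lemma subring0 : L 0. Proof. by case: hL => L1 LB _; rewrite -(subrr 1); apply: LB. Qed.
Lemma subringN x : L x -> L (- x).
Proof. by case: hL => _ LB _ hx; rewrite -sub0r; apply: LB => //; apply: subring0. Qed.
Lemma subringD x y : L x -> L y -> L (x + y).
Proof. by case: hL => _ LB _ hx hy; rewrite -(opprK y); apply/LB/subringN. Qed.
Lemma subringB x y : L x -> L y -> L (x - y). Proof. by case: hL => _ LB _; apply: LB. Qed.
Lemma subringM x y : L x -> L y -> L (x * y). Proof. by case: hL => _ _; apply. Qed.
Lemma subring1 : L 1. Proof. by case: hL. Qed.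
Lemma subring_nat n : L n%:R.
Proof.
elim: n => [|n IH]; first exact: subring0.
by rewrite -addn1 natrD; apply: subringD => //; apply: subring1.
Qed.
Lemma subring_int (n : int) : L n%:~R.
Proof.
by case: n => n; [|rewrite NegzE rmorphN; apply: subringN]; apply: subring_nat.
Qed.
Lemma subring_sum (I : Type) (r : seq I) (P : pred I) (f : I -> F) :
  (forall i, P i -> L (f i)) -> L (\sum_(i <- r | P i) f i).
Proof.
by move=> h; elim/big_rec: _ => [|i x Pi]; [exact: subring0|apply: subringD; apply: h].
Qed.
Lemma subringX x n : L x -> L (x ^+ n).
Proof.
move=> hx; elim: n => [|n IH]; rewrite ?expr0 ?exprS; first exact: subring1.
exact: subringM.
Qed.

Lemma triple_rep_entries A B C :
  \det A = 1 -> \det B = 1 -> \det C = 1 ->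
  (forall i j, L (A i j)) -> (forall i j, L (B i j)) -> (forall i j, L (C i j)) ->
  forall g i j, L (triple_rep A B C g i j).
Proof.
move=> dA dB dC hA hB hC.
apply: (triple_rep_ind (P := fun M => forall i j, L (M i j))) => // [i j|M N hM hN i j|M dM hM].
- by rewrite mxE; apply: subring_nat.
- by rewrite mxE; apply: subring_sum => k _; apply: subringM.
- move: dM; rewrite (mx2_eta M) => /mx2_inv ->.
  by apply: ord2P; apply: ord2P; rewrite mxE /=; do ?apply: subringN.
Qed.

(** Determinant 1 matrices 1 + sN with N over [L] are stable under products and inverses, and det =
    1 forces s tr N = -s^2 det N, which turns the trace 2 + s tr N into 2 - s^2 det N. *)
Lemma triple_rep_congr1 s A B C : L s ->
  \det A = 1 -> \det B = 1 -> \det C = 1 ->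
  (forall M, M \in [:: A; B; C] -> exists2 N : 'M[F]_2,
     forall i j, L (N i j) & M = 1%:M + s *: N) ->
  forall g, exists2 l, L l & \tr (triple_rep A B C g) = 2 + s ^+ 2 * l.
Proof.
move=> Ls dA dB dC hABC g.
pose P (M : 'M[F]_2) := exists2 N : 'M[F]_2, forall i j, L (N i j) & M = 1%:M + s *: N.
have [N hN E] : P (triple_rep A B C g).
  apply: triple_rep_ind => //; try by apply: hABC; rewrite !inE eqxx ?orbT.
  - by exists 0 => [i j|]; rewrite ?scaler0 ?addr0 // mxE; apply: subring0.
  - move=> _ _ [M hM ->] [N hN ->]; exists (M + N + s *: (M *m N)).
      move=> i j; rewrite !mxE; apply: subringD; first exact: subringD.
      by apply: subringM => //; apply: subring_sum => k _; apply: subringM.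
    rewrite mulmxDl !mulmxDr !mul1mx mulmx1 -!scalemxAl -!scalemxAr !scalerDr.
    by rewrite -!addrA; congr (_ + _); rewrite addrCA.
  - move=> M dM [N hN E]; exists (mx2 (N 1 1) (- N 0 1) (- N 1 0) (N 0 0)).
      by apply: ord2P; apply: ord2P; rewrite mxE /=; do ?apply: subringN.
    move: dM; rewrite E (mx2_eta (_ + _)) => /mx2_inv ->.
    by apply: mx2P; rewrite !mxE /=; ring.
have [_ D] := triple_rep_mxrep dA dB dC; move: (D g); rewrite E.
rewrite (mx2_eta (1%:M + _)) mx2_det mx2_tr !mxE /= !mulr1n !mulr0n => h.
exists (- (N 0 0 * N 1 1 - N 0 1 * N 1 0)).
  by apply: subringN; apply: subringB; apply: subringM.
by apply: (eq_combination (k := 1) h); ring.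
Qed.

End Subring.
End Entries.

Section Family.
Variable F : fieldType.
Implicit Types g : F.

(* Each generator is congruent to 1 modulo 2 + g. *)
Definition fam_A g : 'M[F]_2 := mx2 1 (2 + g) 0 1.
Definition fam_B g : 'M[F]_2 := mx2 1 0 (- ((2 + g) / g)) 1.
Definition fam_C g : 'M[F]_2 := mx2 (1 - (2 + g)) (2 + g) (- (2 + g)) (1 + (2 + g)).
Definition fam_rep g := triple_rep (fam_A g) (fam_B g) (fam_C g).
Definition fam_pt g : F * F * F :=
  (2 - (2 + g) ^+ 2 / g, 2 - (2 + g) ^+ 2 / g, 2 - (2 + g) ^+ 2).

Lemma fam_det g : [/\ \det (fam_A g) = 1, \det (fam_B g) = 1 & \det (fam_C g) = 1].
Proof. by split; rewrite mx2_det; ring. Qed.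

Lemma fam_rep_mxrep g : mxrep (fam_rep g).
Proof. by have [? ? ?] := fam_det g; apply: triple_rep_mxrep. Qed.

Lemma fam_rep_loop_tr g i : g != 0 -> \tr (fam_rep g (loop i)) = 2.
Proof.
move=> g0; have [? ? ?] := fam_det g; apply: triple_rep_tr => //.
by rewrite !mx2M !mx2_tr; split; try ring; field.
Qed.

Lemma fam_rep_tr g : g != 0 ->
  fam_pt g = (\tr (fam_rep g (loopA * loopB)%g), \tr (fam_rep g (loopB * loopC)%g),
              \tr (fam_rep g (loopC * loopA)%g)).
Proof.
move=> g0; have [? ? ?] := fam_det g; rewrite /fam_rep !triple_repM // !triple_rep_loop //.
by rewrite /triple_gen /= !mx2M !mx2_tr; congr (_, _, _); (ring || field).
Qed.

Lemma fam_rep_entries (L : F -> Prop) g : subring L -> L g -> L g^-1 -> g != 0 ->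
  forall h i j, L (fam_rep g h i j).
Proof.
move=> hL Lg Lv g0; have [? ? ?] := fam_det g.
have Ls : L (2 + g) by apply: subringD => //; apply: subring_nat.
apply: triple_rep_entries => //; apply: ord2P; apply: ord2P; rewrite mxE /=;
  do ?[exact: subring1|exact: subring0|exact: subringN|exact: Ls].
- by apply: subringN => //; apply: subringM.
- by apply: subringB => //; apply: subring1.
- by apply: subringD => //; apply: subring1.
Qed.

Lemma fam_rep_congr1 (L : F -> Prop) g : subring L -> L g -> L g^-1 -> g != 0 ->
  forall h, exists2 l, L l & \tr (fam_rep g h) = 2 + (2 + g) ^+ 2 * l.
Proof.
move=> hL Lg Lv g0; have [? ? ?] := fam_det g.
have Ls : L (2 + g) by apply: subringD => //; apply: subring_nat.
have [L0 L1] := (subring0 hL, subring1 hL).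
apply: triple_rep_congr1 => // M; rewrite !inE => /or3P [] /eqP ->.
- exists (mx2 0 1 0 0); last by apply: mx2P; rewrite !mxE /=; ring.
  by apply: ord2P; apply: ord2P; rewrite mxE.
- exists (mx2 0 0 (- g^-1) 0); last by apply: mx2P; rewrite !mxE /=; ring.
  by apply: ord2P; apply: ord2P; rewrite mxE //=; apply: subringN.
- exists (mx2 (-1) 1 (-1) 1); last by apply: mx2P; rewrite !mxE /=; ring.
  by apply: ord2P; apply: ord2P; rewrite mxE //=; apply: subringN.
Qed.

End Family.

Section RealFamily.
Variables (R : realType) (K : fieldExtType rat) (iota : {rmorphism K -> R}).
Implicit Types g : K.

Lemma fam_pt_map g : fam_pt (iota g) =
  (iota (fam_pt g).1.1, iota (fam_pt g).1.2, iota (fam_pt g).2).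
Proof.
have h4 : iota 2 = 2 by rewrite rmorph_nat.
have h5 : iota (2 + g) = 2 + iota g by rewrite rmorphD h4.
by rewrite /fam_pt !rmorphB fmorph_div rmorphXn /= h5 h4.
Qed.

Lemma fam_has_character g : g != 0 ->
  has_character (fun h => map_mx iota (fam_rep g h)) (fam_pt (iota g)).
Proof.
move=> g0; have [hM hD] := fam_rep_mxrep g; split.
- by split=> [h k|h]; rewrite ?hM ?map_mxM // det_map_mx hD rmorph1.
- by move=> i; rewrite trace_map_mx fam_rep_loop_tr // rmorph_nat.
- by rewrite fam_pt_map fam_rep_tr // !trace_map_mx.
Qed.

Lemma fam_pt_teichmuller (g : R) : 0 < g -> teichmuller (fam_pt g).
Proof.
move=> g0; have g1 : g != 0 by rewrite gt_eqF.
split; first by rewrite /V2 /=; field.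
(* The numbers 2 - X, 2 - Y, 2 - Z must exceed 4; two of them equal g + 4 + 4/g and the third is (2
   + g)^2. *)
have h : (2 + g) ^+ 2 / g = g + 4 + 4 / g by field.
have h' : 0 < 4 / g by rewrite divr_gt0.
by rewrite /= h; split; nra.
Qed.

Lemma fam_pt_neq2 (g : R) : 0 < g -> (fam_pt g).1.1 != 2.
Proof. by move=> /fam_pt_teichmuller [_ /= [h _ _]]; rewrite lt_eqF //; lra. Qed.

(** Rigidity replaces the unknown representation by [fam_rep g], so congruences satisfied by all
    traces of [fam_rep g] hold for the coordinates along the orbit. *)
Lemma fam_orbit g q : 0 < iota g -> mcg_orbit (fam_pt (iota g)) q ->
  exists h1 h2 h3, q = (iota (\tr (fam_rep g h1)), iota (\tr (fam_rep g h2)),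
                        iota (\tr (fam_rep g h3))).
Proof.
move=> g0; have g1 : g != 0 by rewrite -(fmorph_eq0 iota) gt_eqF.
case=> phi [mphi [rho [hr [_ _ ->]]]].
have E := character_rigid hr (fam_has_character g1) (fam_pt_neq2 g0).
exists (phi (loopA * loopB))%g, (phi (loopB * loopC))%g, (phi (loopC * loopA))%g.
by rewrite /= !E !trace_map_mx.
Qed.

Lemma range_divring_closed : divring_closed (mem (range iota)).
Proof.
split; first by rewrite inE; exists 1; rewrite ?rmorph1.
  move=> _ _ /set_mem [x _ <-] /set_mem [y _ <-]; rewrite inE.
  by exists (x - y); rewrite ?rmorphB.
move=> _ _ /set_mem [x _ <-] /set_mem [y _ <-]; rewrite inE.
by exists (x / y); rewrite ?fmorph_div.
Qed.

Lemma iota_rat (r : rat) : iota (r%:A) = ratr r.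
Proof. exact: (fmorph_eq_rat (iota \o in_alg K)). Qed.

(** All traces lie in the image of K; conversely g = (2 - Z) / (2 - X) belongs to the trace field,
    and g generates K. *)
Lemma fam_trace_field g : 0 < iota g ->
  (forall x : K, exists p : {poly rat}, x = (map_poly (in_alg K) p).[g]) ->
  trace_field (fam_pt (iota g)) = range iota.
Proof.
move=> g0 gen; have g1 : g != 0 by rewrite -(fmorph_eq0 iota) gt_eqF.
have hc := fam_has_character g1.
rewrite eqEsubset; split.
  apply: smallest_sub; first exact: range_divring_closed.
  move=> t [rho [h [hr ->]]]; exists (\tr (fam_rep g h)) => //.
  by rewrite (character_rigid hr hc (fam_pt_neq2 g0)) trace_map_mx.
move=> _ [x _ <-] E [[E1 EB ED] Etr].
have e1 : E 1 by move: E1; rewrite inE.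
have eB a b : E a -> E b -> E (a - b).
  by move=> ha hb; have := EB a b; rewrite !inE; apply.
have eD a b : E a -> E b -> E (a / b).
  by move=> ha hb; have := ED a b; rewrite !inE; apply.
have hE : subring E.
  split=> // a b ha hb; rewrite -[b]invrK; apply: (eD) => //.
  by rewrite -[_^-1]mul1r; apply: eD.
have [_ _ [hX _ hZ]] := hc.
have EX : E ((fam_pt (iota g)).1.1) 
  by apply: Etr; exists (fun h => map_mx iota (fam_rep g h)), (loopA * loopB)%g.
have EZ : E ((fam_pt (iota g)).2) 
  by apply: Etr; exists (fun h => map_mx iota (fam_rep g h)), (loopC * loopA)%g.
have s0 : 2 + iota g != 0 by rewrite gt_eqF // addr_gt0.
have g2 : iota g != 0 by rewrite gt_eqF.
have Eg : E (iota g).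
  have -> : iota g = (2 - (fam_pt (iota g)).2) / (2 - (fam_pt (iota g)).1.1).
    by rewrite /fam_pt /=; field; rewrite g2 opprB addrC subrK sqrf_eq0 s0.
  by apply: (eD); apply: (eB) => //; apply: (subring_nat hE 2).
have [p ->] := gen x.
rewrite -horner_map -map_poly_comp horner_coef; apply: (subring_sum hE) => i _.
apply: (subringM hE); last exact: (subringX hE).
rewrite coef_map /= iota_rat /ratr.
by apply: (eD); apply: (subring_int hE).
Qed.

End RealFamily.

(** * Finite places *)

Section Places.
Variable K : fieldExtType rat.
Implicit Types v w : finite_place K.

Lemma place1 v : v 1 = 0.
Proof.
have := val_atM v (oner_neq0 K) (oner_neq0 K); rewrite mulr1 => h.
by apply: (addIr (v 1)); rewrite -h add0r.
Qed.

Lemma placeN v x : v (- x) = v x.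
Proof.
have [->|x0] := eqVneq x 0; first by rewrite oppr0.
have N1 : (-1 : K) != 0 by rewrite oppr_eq0 oner_neq0.
have := val_atM v N1 N1; rewrite mulrNN mulr1 place1 => h.
rewrite -mulN1r val_atM //; move: (v (-1)) h => n h.
by rewrite (_ : n = 0) ?add0r; lia.
Qed.

Lemma place_geD v m x y : (x = 0 \/ m <= v x) -> (y = 0 \/ m <= v y) ->
  x + y = 0 \/ m <= v (x + y).
Proof.
move=> hx hy; have [xy0|xy] := eqVneq (x + y) 0; first by left.
have [x0|x0] := eqVneq x 0; first by rewrite x0 add0r in xy *.
have [y0|y0] := eqVneq y 0; first by rewrite y0 addr0 in xy *.
right; apply: le_trans (val_atD v x0 y0 xy); rewrite le_min.
by apply/andP; split; [case: hx => [/eqP|//]|case: hy => [/eqP|//]];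
  rewrite ?(negPf x0) ?(negPf y0).
Qed.

Lemma place_ge0_subring v : subring (fun x : K => 0 <= v x).
Proof.
have ge0 x : 0 <= v x <-> x = 0 \/ 0 <= v x.
  by split=> [|[->|//]]; [right|rewrite val_at0].
split; first by rewrite place1.
  move=> x y hx hy; apply/ge0/place_geD; first exact/ge0.
  by apply/ge0; rewrite placeN.
move=> x y hx hy; have [->|x0] := eqVneq x 0; first by rewrite mul0r val_at0.
have [->|y0] := eqVneq y 0; first by rewrite mulr0 val_at0.
by rewrite val_atM // addr_ge0.
Qed.

Lemma S_integers_subring (S : set (finite_place K)) : subring (S_integers S).
Proof.
split.
- by move=> v _; exact: subring1 (place_ge0_subring v).
- by move=> x y hx hy v Sv; apply: (subringB (place_ge0_subring v)); [exact: hx|exact: hy].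
- by move=> x y hx hy v Sv; apply: (subringM (place_ge0_subring v)); [exact: hx|exact: hy].
Qed.

Lemma place_int v (n : int) : 0 <= v n%:~R.
Proof. exact: subring_int (place_ge0_subring v) n. Qed.

End Places.

(** At [r = 0] the value is 0, in agreement with [val_at0]. *)
Definition padic (p : nat) (r : rat) : int :=
  (logn p `|numq r|)%:Z - (logn p `|denq r|)%:Z.

Lemma padic_frac p (a b : int) : a != 0 -> b != 0 ->
  padic p (a%:~R / b%:~R) = (logn p `|a|)%:Z - (logn p `|b|)%:Z.
Proof.
move=> a0 b0; set r := _ / _.
have r0 : r != 0 by rewrite mulf_neq0 ?invr_eq0 ?intr_eq0.
have : numq r * b = a * denq r.
  apply: (@intr_inj rat); rewrite !rmorphM /=.
  rewrite numqE /r mulrAC divfK ?intr_eq0 //.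
move=> /(congr1 absz); rewrite !abszM => /(congr1 (logn p)).
rewrite !lognM ?absz_gt0 ?numq_eq0 ?denq_eq0 //.
by rewrite /padic; lia.
Qed.

Lemma rat_common_denom (r s : rat) : exists a c b : int,
  [/\ b != 0, r = a%:~R / b%:~R & s = c%:~R / b%:~R].
Proof.
exists (numq r * denq s), (numq s * denq r), (denq r * denq s); split.
- by rewrite mulf_neq0 ?denq_eq0.
- rewrite -{1}[r]divq_num_den !rmorphM /=; field.
  by rewrite !intr_eq0 !denq_eq0.
- rewrite -{1}[s]divq_num_den !rmorphM /=; field.
  by rewrite !intr_eq0 !denq_eq0.
Qed.

Lemma padicM p r s : r != 0 -> s != 0 -> padic p (r * s) = padic p r + padic p s.
Proof.
have [a [c [b [b0 -> ->]]]] := rat_common_denom r s.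
rewrite !mulf_eq0 !invr_eq0 !intr_eq0 (negPf b0) !orbF => a0 c0.
rewrite mulf_div -!rmorphM /= !padic_frac ?mulf_neq0 // !abszM !lognM ?absz_gt0 //.
by lia.
Qed.

Lemma padicD p r s : prime p -> r != 0 -> s != 0 -> r + s != 0 ->
  Num.min (padic p r) (padic p s) <= padic p (r + s).
Proof.
move=> pp; have [a [c [b [b0 -> ->]]]] := rat_common_denom r s.
rewrite -mulrDl -rmorphD /=.
rewrite !mulf_eq0 !invr_eq0 !intr_eq0 (negPf b0) !orbF => a0 c0 ac0.
rewrite !padic_frac //.
suff : (minn (logn p `|a|) (logn p `|c|) <= logn p `|(a + c)%R|)%N.
  by rewrite geq_min ge_min !lerD2r !lez_nat.
have hd (e : int) : e != 0 -> forall m, ((p ^ m)%N%:Z %| e)%Z = (m <= logn p `|e|)%N.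
  by move=> e0 m; rewrite dvdzE pfactor_dvdn ?absz_gt0.
by rewrite -hd // rpredD // hd // ?geq_minl ?geq_minr.
Qed.

Section RationalField.
Variables (R : realType) (K : fieldExtType rat) (iota : {rmorphism K -> R}).
Hypothesis KQ : range iota = range (@ratr R).

Lemma rational_elt (x : K) : exists r : rat, x = r%:A.
Proof.
have : range (@ratr R) (iota x) by rewrite -KQ; exists x.
by case=> r _ h; exists r; apply: (fmorph_inj iota); rewrite iota_rat h.
Qed.

(** [f] inverts the embedding of the rationals in K, and the p-adic valuation is transported along
    it. *)
Lemma padic_place (p : nat) : prime p ->
  exists v : finite_place K, forall r : rat, v (r%:A) = padic p r.
Proof.
move=> pp; have [f hf] := choice rational_elt.
have inj (r s : rat) : r%:A = s%:A :> K -> r = s by move=> /(fmorph_inj (in_alg K)).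
have fE (r : rat) : f (r%:A) = r by apply: inj; rewrite -hf.
have f0 x : x != 0 -> f x != 0.
  by apply: contraNneq => h; rewrite (hf x) h scale0r.
have fM x y : f (x * y) = f x * f y.
  by apply: inj; rewrite -hf {1}(hf x) {1}(hf y) -scalerAl mul1r scalerA.
have fD x y : f (x + y) = f x + f y.
  by apply: inj; rewrite -hf {1}(hf x) {1}(hf y) scalerDl.
have v0 : padic p (f 0) = 0.
  have -> : f 0 = 0 by apply: inj; rewrite -hf scale0r.
  by rewrite /padic (_ : numq 0 = 0) // (_ : denq 0 = 1) // absz0 logn0 logn1.
have vM x y : x != 0 -> y != 0 -> padic p (f (x * y)) = padic p (f x) + padic p (f y).
  by move=> x0 y0; rewrite fM padicM // f0.
have vD x y : x != 0 -> y != 0 -> x + y != 0 ->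
    Num.min (padic p (f x)) (padic p (f y)) <= padic p (f (x + y)).
  by move=> x0 y0 xy0; rewrite fD padicD ?f0 // -fD f0.
have vn : exists x, padic p (f x) = 1.
  exists ((p%:R : rat)%:A); rewrite fE.
  have -> : (p%:R : rat) = (p%:Z)%:~R / 1%:~R by rewrite divr1.
  have p0 : p%:Z != 0 by rewrite eqz_nat -lt0n prime_gt0.
  by rewrite padic_frac // !absz_nat logn_prime // eqxx logn1.
by exists (FinitePlace v0 vM vD vn) => r /=; rewrite fE.
Qed.

(** A prime factor of the denominator would give a place where [x] has negative value. *)
Lemma integral_elt (x : K) : S_integers set0 x -> exists n : int, x = n%:~R.
Proof.
have [r ->] := rational_elt x; move=> hr.
suff d1 : denq r = 1.
  exists (numq r); rewrite -[r in LHS]divq_num_den d1 divr1.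
  by rewrite -[_%:A]/(in_alg K _) rmorph_int.
have [//|] := eqVneq (denq r) 1; move: (denq_gt0 r) => d0 d1.
have hp : prime (pdiv `|denq r|) by apply: pdiv_prime; lia.
have [v hv] := padic_place hp; have := hr v id; rewrite hv /padic.
have -> : logn (pdiv `|denq r|) `|numq r| = 0%N.
  apply/eqP; rewrite -leqn0 leqNgt logn_gt0 mem_primes; apply/negP => /and3P [_ _ h].
  have := coprime_num_den r; rewrite /coprime => /eqP hc.
  have : (pdiv `|denq r| %| 1)%N by rewrite -hc dvdn_gcd h pdiv_dvd.
  by rewrite dvdn1 => /eqP h1; move: hp; rewrite h1.
have : (0 < logn (pdiv `|denq r|) `|denq r|)%N.
  by rewrite logn_gt0 mem_primes hp pdiv_dvd andbT; lia.
by lia.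
Qed.

End RationalField.

(** * The Markov-type equation over the integers *)

Section Descent.
Implicit Types x y z : int.

Definition markov x y z : Prop := (x + y + z) ^+ 2 = x * y * z.

(** If c <= 4, then abc <= 4ab <= (a + b)^2 < (a + b + c)^2. The equation is symmetric, so this
    applies to each variable. *)
Lemma markov_gt4 x y z : 0 < x -> 0 < y -> 0 < z -> markov x y z ->
  [/\ 4 < x, 4 < y & 4 < z].
Proof.
rewrite /markov => x0 y0 z0 h.
have H (a b c : int) : 0 < a -> 0 < b -> 0 < c -> (a + b + c) ^+ 2 = a * b * c -> 4 < c.
  move=> a0 b0 c0 E; rewrite ltNge; apply/negP => c4.
  have h1 : a * b * c <= a * b * 4 by rewrite ler_pM2l ?mulr_gt0.
  have h2 : 0 <= (a - b) ^+ 2 by apply: sqr_ge0.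
  have h3 : 0 < c * (a + b) by rewrite mulr_gt0 ?addr_gt0.
  have h4 : 0 < c ^+ 2 by rewrite exprn_gt0.
  by nia.
split; [apply: (H y z x)|apply: (H x z y)|apply: (H x y z)] => //.
- by rewrite -[RHS]mulrC mulrA -h; congr (_ ^+ 2); ring.
- by rewrite mulrAC -h; congr (_ ^+ 2); ring.
Qed.

(** As x is the largest entry, (x + y + z)^2 <= 9x^2 gives yz <= 9x <= 9(y + z) <= 18y, hence z <=
    18. Then 5y^2 <= xyz <= 4(y + 18)^2 bounds y, and x <= y + z. The values 160 and 200 are not
    sharp. *)
Lemma markov_reduced_bound x y z : 0 < x -> 0 < y -> 0 < z -> markov x y z ->
  z <= y -> y <= x -> x <= y + z -> x <= 200.
Proof.
move=> x0 y0 z0 h zy yx xyz; have [_ _ z4] := markov_gt4 x0 y0 z0 h.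
rewrite /markov in h.
have z18 : z <= 18.
  rewrite leNgt; apply/negP => z18.
  have h1 : (x + y + z) ^+ 2 <= (3 * x) ^+ 2 by rewrite lerXn2r ?nnegrE; lia.
  have h2 : y * z <= 9 * x.
    by rewrite -(ler_pM2l x0) mulrA -h (_ : x * (9 * x) = (3 * x) ^+ 2) //; ring.
  have h3 : y * 19 <= y * z by rewrite ler_pM2l //; lia.
  by lia.
have h1 : (x + y + z) ^+ 2 <= (2 * (y + z)) ^+ 2 by rewrite lerXn2r ?nnegrE; lia.
have h2 : y * y * 5 <= x * y * z.
  apply: ler_pM; [by rewrite mulr_ge0 ?ltW|by []|by rewrite ler_pM2r|by lia].
have h3 : (2 * (y + z)) ^+ 2 <= (2 * (y + 18)) ^+ 2 by rewrite lerXn2r ?nnegrE; lia.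
have : y <= 160 by nia.
by lia.
Qed.

End Descent.

(** * Descent on integral points *)

Section IntegralPoints.
Variable R : realType.
Implicit Types x y z : int.

Definition int_pt x y z : R * R * R := (2 - x%:~R, 2 - y%:~R, 2 - z%:~R).

Lemma int_pt_V2 x y z : markov x y z <-> V2 (int_pt x y z).
Proof.
have E : (x%:~R + y%:~R + z%:~R) ^+ 2 - x%:~R * y%:~R * z%:~R =
    ((x + y + z) ^+ 2 - x * y * z)%:~R :> R.
  by rewrite rmorphB rmorphXn !rmorphD !rmorphM.
rewrite /V2 /int_pt /= /markov; split=> h.
  transitivity ((x%:~R + y%:~R + z%:~R) ^+ 2 - x%:~R * y%:~R * z%:~R : R); first by ring.
  by rewrite E h subrr.
apply/eqP; rewrite -subr_eq0 -(intr_eq0 R) -E; apply/eqP; rewrite -[RHS]h; ring.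
Qed.

Lemma int_pt_neq2 x y z : 0 < x -> (int_pt x y z).1.1 != 2.
Proof.
move=> x0; rewrite /= subr_eq -subr_eq0 opprD addrA subrr sub0r oppr_eq0.
by rewrite intr_eq0 gt_eqF.
Qed.

Lemma int_pt_eq x y z x' y' z' : x = x' -> y = y' -> z = z' ->
  int_pt x y z = int_pt x' y' z'.
Proof. by move=> -> -> ->. Qed.

Lemma int_pt_twist_AB x y z : 0 < x -> markov x y z ->
  mcg_orbit (int_pt x y z) = mcg_orbit (int_pt x z (x * z - 2 * x - 2 * z - y)).
Proof.
move=> x0 h; have p2 := int_pt_neq2 y z x0.
apply: mcg_orbit_eq => //; have := mcg_half_twist_AB ((int_pt_V2 x y z).1 h) p2.
by congr (mcg_orbit _ (_, _, _)); rewrite /= !rmorphB !rmorphM /=; ring.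
Qed.

Lemma int_pt_twist_BC x y z : 0 < x -> markov x y z -> 0 < x * y - 2 * x - 2 * y - z ->
  mcg_orbit (int_pt x y z) = mcg_orbit (int_pt (x * y - 2 * x - 2 * y - z) y x).
Proof.
move=> x0 h x0'; have p2 := int_pt_neq2 y z x0.
apply: mcg_orbit_eq => //; first exact: int_pt_neq2.
have := mcg_half_twist_BC ((int_pt_V2 x y z).1 h) p2.
by congr (mcg_orbit _ (_, _, _)); rewrite /= !rmorphB !rmorphM /=; ring.
Qed.

(* Vieta: the two roots in x of the cubic have product (y + z)^2. *)
Lemma markov_vieta x y z : 0 < x -> 0 < y -> 0 < z -> markov x y z -> y + z < x ->
  [/\ 0 < y * z - 2 * y - 2 * z - x, y * z - 2 * y - 2 * z - x < x &
      markov z y (y * z - 2 * y - 2 * z - x)].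
Proof.
move=> x0 y0 z0 h xyz; set x' := _ - x.
have E : x * x' = (y + z) ^+ 2.
  by apply: (eq_combination (k := -1) h); rewrite /x'; ring.
have yz0 : 0 < y + z by rewrite addr_gt0.
have x'0 : 0 < x' by rewrite -(pmulr_rgt0 _ x0) E exprn_gt0.
split=> //; last by apply: (eq_combination (k := 1) h); rewrite /x'; ring.
rewrite -(ltr_pM2l x0) E expr2; apply: ltr_pM => //; exact: ltW.
Qed.

Lemma markov_perm x y z x' y' z' : markov x y z -> x' + y' + z' = x + y + z ->
  x' * y' * z' = x * y * z -> markov x' y' z'.
Proof. by rewrite /markov => h -> ->. Qed.

Lemma markov_reduced_bounds x y z : 0 < x -> 0 < y -> 0 < z -> markov x y z ->
  x <= y + z -> y <= x + z -> z <= x + y -> [/\ x <= 200, y <= 200 & z <= 200].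
Proof.
move=> x0 y0 z0 h hx hy hz.
have B a b c : 0 < a -> 0 < b -> 0 < c -> a + b + c = x + y + z ->
    a * b * c = x * y * z -> c <= b -> b <= a -> a <= b + c -> a <= 200.
  by move=> a0 b0 c0 e1 e2; apply: markov_reduced_bound => //; apply: markov_perm h e1 e2.
have [xy|yx] : x <= y \/ y <= x by lia.
all: have [yz|zy] : y <= z \/ z <= y by lia.
all: have [xz|zx] : x <= z \/ z <= x by lia.
- have H : z <= 200 by apply: (B z y x) => //; [ring|ring|lia].
  by split; lia.
- have H : z <= 200 by apply: (B z y x) => //; [ring|ring|lia].
  by split; lia.
- have H : y <= 200 by apply: (B y z x) => //; [ring|ring|lia].
  by split; lia.
- have H : y <= 200 by apply: (B y x z) => //; ring.
  by split; lia.
- have H : z <= 200 by apply: (B z x y) => //; ring.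
  by split; lia.
- have H : x <= 200 by apply: (B x z y) => //; [ring|ring|lia].
  by split; lia.
- have H : x <= 200 by apply: (B x y z).
  by split; lia.
- have H : x <= 200 by apply: (B x y z).
  by split; lia.
Qed.

(** Induction on a bound for x + y + z: an entry larger than the sum of the other two is lowered by
    a Vieta twist, and a triple without such an entry lies in the box. *)
Lemma int_pt_descent (n : nat) x y z : 0 < x -> 0 < y -> 0 < z -> markov x y z ->
  x + y + z <= n%:Z -> exists a b c : 'I_201,
  mcg_orbit (int_pt x y z) = mcg_orbit (int_pt a%:Z b%:Z c%:Z).
Proof.
elim: n x y z => [|n IH] x y z x0 y0 z0 h hn; first lia.
have [hx|hx] := ltP (y + z) x.
  have [x'0 x'x h'] := markov_vieta x0 y0 z0 h hx.
  have [|a [b [c hz]]] := IH z y (y * z - 2 * y - 2 * z - x) z0 y0 x'0 h'.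
    by lia.
  (* The twist is applied to the smaller triple, which it carries back to (x, y, z). *)
  exists a, b, c; rewrite -hz (int_pt_twist_BC z0 h').
    by congr mcg_orbit; apply: int_pt_eq => //; ring.
  by rewrite (_ : _ - _ = x) //; ring.
have [hy|hy] := ltP (x + z) y.
  have h1 : markov y x z by apply: markov_perm h _ _; ring.
  have [y'0 y'y h'] := markov_vieta y0 x0 z0 h1 hy.
  have h2 : markov x z (x * z - 2 * x - 2 * z - y) by apply: markov_perm h' _ _; ring.
  have [|a [b [c hz']]] := IH x z (x * z - 2 * x - 2 * z - y) x0 z0 y'0 h2.
    by lia.
  by exists a, b, c; rewrite -hz' int_pt_twist_AB.
have [hz|hz] := ltP (x + y) z.
  have h1 : markov z x y by apply: markov_perm h _ _; ring.
  have [z'0 z'z h'] := markov_vieta z0 x0 y0 h1 hz.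
  have h2 : markov (x * y - 2 * x - 2 * y - z) y x by apply: markov_perm h' _ _; ring.
  have [|a [b [c hz']]] := IH (x * y - 2 * x - 2 * y - z) y x z'0 y0 x0 h2.
    by lia.
  by exists a, b, c; rewrite -hz' int_pt_twist_BC.
have [bx by_ bz] := markov_reduced_bounds x0 y0 z0 h hx hy hz.
have H (t : int) : 0 < t -> t <= 200 -> exists a : 'I_201, t = a%:Z.
  move=> t0 t200; have ht : (`|t| < 201)%N by lia.
  by exists (Ordinal ht) => /=; lia.
have [[a ->] [[b ->] [c ->]]] := (H x x0 bx, (H y y0 by_, H z z0 bz)).
by exists a, b, c.
Qed.

End IntegralPoints.

(** An integral coordinate is 2 - n with n an integer, and being below -2 makes n positive; the
    descent then leaves at most 201^3 orbits. *)
Lemma finite_integral_orbits (R : realType) (K : fieldExtType rat)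
    (iota : {rmorphism K -> R}) : range iota = range (@ratr R) ->
  finite_set [set mcg_orbit p | p in @teichmuller R `&` S_integral_points iota set0].
Proof.
move=> KQ.
pose f (t : 'I_201 * 'I_201 * 'I_201) : set (R * R * R) :=
  mcg_orbit (int_pt R t.1.1%:Z t.1.2%:Z t.2%:Z).
apply: (@sub_finite_set _ _ (f @` setT)); last exact: finite_image.
move=> _ [p [[Vp hp] [x [y [z [hx hy hz Ep]]]]] <-].
have int_coord (k : K) : S_integers set0 k -> exists n : int, iota k = 2 - n%:~R.
  move=> /(integral_elt KQ) [n ->]; exists (2 - n).
  by rewrite rmorph_int rmorphB /=; ring.
have [a Ea] := int_coord _ hx; have [b Eb] := int_coord _ hy.
have [c Ec] := int_coord _ hz.
have {}Ep : p = int_pt R a b c by rewrite Ep Ea Eb Ec.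
rewrite Ep in Vp hp *; case: hp => ha hb hc.
have pos (n : int) : 2 - n%:~R < -2 :> R -> 0 < n.
  by move=> h; rewrite -(ltr0z R); lra.
have [i [j [k E]]] := @int_pt_descent R `|(a + b + c)%R|%N a b c (pos _ ha) (pos _ hb) (pos _ hc)
  ((int_pt_V2 R a b c).2 Vp) ltac:(lia).
by exists (i, j, k).
Qed.

(** * Places over a prime *)

(** Otherwise the natural numbers would be a finite union of finite fibres. The lemma provides an
    orbit, or a residue class, that recurs at arbitrarily large indices. *)
Lemma infinite_fiber (T : Type) (f : nat -> T) : finite_set (range f) ->
  exists m, forall b, exists2 n, (b <= n)%N & f n = f m.
Proof.
move=> fin; apply: contrapT => /forallNP h.
have fib t : range f t -> finite_set (f @^-1` [set t]).
  case=> m _ <-; have /existsNP [b hb] := h m.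
  apply: (@sub_finite_set _ _ `I_b); last exact: finite_II.
  by move=> n /= hn; rewrite ltnNge; apply/negP => bn; apply: hb; exists n.
apply: infinite_nat; apply: (sub_finite_set _ (bigcup_finite fin fib)).
by move=> n _; exists (f n) => //; exists n.
Qed.

Section PlaceOverPrime.
Variables (R : realType) (K : fieldExtType rat) (iota : {rmorphism K -> R}).
Hypothesis KQ : range iota = range (@ratr R).
Implicit Types v w : finite_place K.

Lemma fext_nat_eq0 n : (n%:R == 0 :> K) = (n == 0%N).
Proof. by rewrite -(fmorph_eq0 iota) rmorph_nat pnatr_eq0. Qed.

Lemma fext_int_eq0 (n : int) : (n%:~R == 0 :> K) = (n == 0).
Proof. by rewrite -(fmorph_eq0 iota) rmorph_int intr_eq0. Qed.

Lemma fext_int_inj : injective (fun n : int => n%:~R : K).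
Proof. by move=> m n /eqP; rewrite -subr_eq0 -rmorphB fext_int_eq0 subr_eq0 => /eqP. Qed.

Lemma placeX v x n : x != 0 -> v (x ^+ n) = n%:Z * v x.
Proof.
move=> x0; elim: n => [|n IH]; first by rewrite expr0 place1 mul0r.
by rewrite exprS val_atM ?expf_neq0 // IH -add1n PoszD mulrDl mul1r.
Qed.

Lemma place_nat v n : 0 <= v n%:R.
Proof. exact: subring_nat (place_ge0_subring v) n. Qed.

(** A Bezout relation writes 1 as a combination of p and n, so they cannot both have positive
    value. *)
Lemma place_coprime v p n : 0 < v p%:R -> coprime p n -> v n%:R = 0.
Proof.
move=> vp /coprimeP; have p0 : p%:R != 0 :> K.
  by apply: contraTneq vp => ->; rewrite val_at0.
have [->|n0] := posnP n; first by rewrite val_at0.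
have n0' : n%:R != 0 :> K by rewrite fext_nat_eq0 -lt0n.
have pgt0 : (0 < p)%N by rewrite lt0n -fext_nat_eq0.
move=> /(_ pgt0) [[a b] /= hab].
apply/eqP; rewrite eq_le place_nat andbT leNgt; apply/negP => vn.
have E : 1 = a%:R * p%:R - b%:R * n%:R :> K.
  by rewrite -!natrM -natrB ?hab //; lia.
have ge1 (c d : nat) : 0 < v d%:R -> d%:R != 0 :> K ->
    (c%:R * d%:R : K) = 0 \/ 1 <= v (c%:R * d%:R).
  move=> vd d0; have [->|c0] := eqVneq (c%:R : K) 0; first by left; rewrite mul0r.
  right; rewrite val_atM //; have := place_nat v c; move: (v _) (v _) vd; lia.
have [] := place_geD (v := v) (m := 1) (x := a%:R * p%:R) (y := - (b%:R * n%:R)).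
- exact: ge1.
- by case: (ge1 b n vn n0') => [->|h]; [left; rewrite oppr0|right; rewrite placeN].
- by rewrite -E => /eqP; rewrite oner_eq0.
- by rewrite -E place1.
Qed.

Lemma place_logn v p n : prime p -> 0 < v p%:R -> (0 < n)%N ->
  v n%:R = (logn p n)%:Z * v p%:R.
Proof.
move=> pp vp n0; have p0 : p%:R != 0 :> K.
  by apply: contraTneq vp => ->; rewrite val_at0.
have [q hq ->] := pfactor_coprime pp n0.
have pgt0 := prime_gt0 pp; have q0 : (0 < q)%N.
  rewrite lt0n; apply: contraTneq hq => ->.
  by rewrite /coprime gcdn0 gtn_eqF // prime_gt1.
rewrite natrM natrX val_atM ?expf_neq0 ?fext_nat_eq0 -?lt0n //.
rewrite placeX // (place_coprime vp hq) add0r lognM ?expn_gt0 ?(prime_gt0 pp) //.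
by rewrite pfactorK // (_ : logn p q = 0%N) // logn_coprime.
Qed.

(** Values on rationals are [padic p] times [v p%:R], and normalization makes this factor 1. *)
Lemma place_padic v p : prime p -> 0 < v p%:R -> forall r : rat, v (r%:A) = padic p r.
Proof.
move=> pp vp; have int_val (a : int) : a != 0 -> v a%:~R = (logn p `|a|)%:Z * v p%:R.
  move=> a0; rewrite -(place_logn pp vp) ?absz_gt0 //.
  by case: a a0 => a _ //; rewrite NegzE rmorphN placeN.
have A (n : int) : (n%:~R : rat)%:A = n%:~R :> K by exact: (rmorph_int (in_alg K)).
have frac_val (r : rat) : r != 0 -> v (r%:A) = padic p r * v p%:R.
  move=> r0; have n0 : numq r != 0 by rewrite numq_eq0.
  have r0' : (r%:A : K) != 0 by rewrite scaler_eq0 negb_or r0 oner_neq0.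
  have d0 : denq r != 0 by rewrite denq_eq0.
  have := int_val _ n0; rewrite -A numqE.
  rewrite -[_%:A]/(in_alg K _) rmorphM /= A val_atM ?fext_int_eq0 // int_val //.
  by rewrite /padic mulrBl => <-; rewrite addrK.
have vp1 : v p%:R = 1.
  have [x vx] := val_at_normalized v; have [r xr] := rational_elt KQ x.
  have r0 : r != 0 by apply: contraTneq isT => r0; move: vx; rewrite xr r0 scale0r val_at0.
  move: vx; rewrite xr frac_val //; move: (padic p r) (v p%:R) vp => a b b0 hab.
  have a0 : 0 < a by rewrite -(pmulr_lgt0 a b0) hab.
  by have : 1 * b <= a * b by [rewrite ler_pM2r //; lia]; lia.
move=> r; have [->|r0] := eqVneq r 0; last by rewrite frac_val // vp1 mulr1.
by rewrite scale0r val_at0 /padic (_ : numq 0 = 0) // (_ : denq 0 = 1) // absz0 logn0 logn1.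
Qed.

(** The numerator of an element of value 1 has positive value; splitting off prime factors of value
    0 by strong induction ends at a prime of positive value. *)
Lemma place_prime v : exists2 p, prime p & 0 < v p%:R.
Proof.
have [x vx] := val_at_normalized v; have [r xr] := rational_elt KQ x.
have A (n : int) : (n%:~R : rat)%:A = n%:~R :> K by exact: (rmorph_int (in_alg K)).
have x0 : x != 0 by apply: contraTneq isT => x0; move: vx; rewrite x0 val_at0.
have vnum : 0 < v (numq r)%:~R.
  rewrite -A numqE -[_%:A]/(in_alg K _) rmorphM /= A -xr val_atM // ?fext_int_eq0 ?denq_eq0 //.
  by rewrite vx; have := place_int v (denq r); move: (v _) => m; lia.
have : 0 < v (`|numq r|%N)%:R.
  by case: (numq r) vnum => n //; rewrite NegzE rmorphN placeN.
elim/ltn_ind: `|numq r|%N => n IH vn.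
have n0 : (0 < n)%N by rewrite lt0n; apply: contraTneq vn => ->; rewrite val_at0.
have n1 : (1 < n)%N by rewrite ltn_neqAle n0 andbT; apply: contraTneq vn => <-; rewrite place1.
have pp := pdiv_prime n1; have [h|h] := ltP 0 (v (pdiv n)%:R); first by exists (pdiv n).
have En := divnK (pdiv_dvd n).
have q0 : (0 < n %/ pdiv n)%N by rewrite divn_gt0 ?pdiv_gt0 // dvdn_leq ?pdiv_dvd.
apply: (IH (n %/ pdiv n)%N); first by rewrite ltn_Pdiv // prime_gt1.
move: vn; rewrite -{1}En natrM val_atM ?fext_nat_eq0 -?lt0n ?pdiv_gt0 //.
by move: (v _) (v _) h; lia.
Qed.

Lemma place_unique v w p : prime p -> 0 < v p%:R -> 0 < w p%:R -> v = w.
Proof.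
move=> pp vp wp; have E : val_at v = val_at w.
  apply: funext => x; have [r ->] := rational_elt KQ x.
  by rewrite (place_padic pp vp) (place_padic pp wp).
case: v w E {vp wp} => [f f0 fM fD fn] [g g0 gM gD gn] /= E; subst g.
by congr FinitePlace; apply: Prop_irrelevance.
Qed.

End PlaceOverPrime.

Lemma fam_pt_S_integral (R : realType) (K : fieldExtType rat)
    (iota : {rmorphism K -> R}) (S : set (finite_place K)) (g : K) :
  S_integers S g -> S_integers S g^-1 -> S_integral_points iota S (fam_pt (iota g)).
Proof.
move=> hg hV; have hS := S_integers_subring S.
have h2 : S_integers S 2 := subring_nat hS 2.
have hs : S_integers S ((2 + g) ^+ 2) by apply: (subringX hS); apply: (subringD hS).
exists (2 - (2 + g) ^+ 2 / g), (2 - (2 + g) ^+ 2 / g), (2 - (2 + g) ^+ 2); split.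
- by apply: (subringB hS) => //; apply: (subringM hS).
- by apply: (subringB hS) => //; apply: (subringM hS).
- exact: (subringB hS).
- exact: fam_pt_map.
Qed.

(** * Infinitely many orbits over the rationals with an inverted prime *)

Section InvertedPrime.
Variables (R : realType) (K : fieldExtType rat) (iota : {rmorphism K -> R}).
Hypothesis KQ : range iota = range (@ratr R).
Variable p : nat.
Hypothesis p_prime : prime p.

(** The subring Z[1/p] of K. *)
Definition inverted_prime (x : K) : Prop :=
  exists (j : nat) (l : int), x * p%:R ^+ j = l%:~R.

Let p0 : p%:R != 0 :> K.
Proof. by rewrite (fext_nat_eq0 iota) -lt0n prime_gt0. Qed.

Lemma inverted_prime_subring : subring inverted_prime.
Proof.
split; first by exists 0%N, 1; rewrite mulr1.
  move=> x y [i [k hx]] [j [l hy]]; exists (i + j)%N, (k * p%:Z ^+ j - l * p%:Z ^+ i).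
  rewrite mulrBl {1}exprD mulrA hx addnC exprD mulrA hy.
  by rewrite rmorphB !rmorphM !rmorphXn.
move=> x y [i [k hx]] [j [l hy]]; exists (i + j)%N, (k * l).
by rewrite exprD mulrACA hx hy rmorphM.
Qed.

Lemma inverted_prime_pow n : inverted_prime (p%:R ^+ n).
Proof.
have hL := inverted_prime_subring.
by apply: (subringX hL); apply: (subring_nat hL).
Qed.

Lemma inverted_prime_powV n : inverted_prime (p%:R ^- n).
Proof. by exists n, 1; rewrite mulVf // expf_neq0. Qed.

(** Only one place lies over p, and it belongs to [S]; at every other place p has value 0, so Z[1/p]
    is integral there. *)
Lemma inverted_prime_S_integers (S : set (finite_place K)) v x :
  S v -> 0 < v p%:R -> inverted_prime x -> S_integers S x.
Proof.
move=> Sv vp [j [l hx]] w Sw; have [->|x0] := eqVneq x 0; first by rewrite val_at0.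
have wp : w p%:R = 0.
  apply/eqP; rewrite eq_le place_nat andbT leNgt; apply/negP => wp.
  by apply: Sw; rewrite (place_unique KQ p_prime wp vp).
have := place_int w l; rewrite -hx val_atM ?expf_neq0 // placeX // wp mulr0 addr0.
by [].
Qed.

(** Divisibility of 2 - Z by (2 + p^-n)^2 in Z[1/p] means, after clearing denominators, that (2p^n +
    1)^2 divides (2p^m + 1)^2 times a power of p. As 2p^n + 1 is prime to p for n > 0, it is at most
    2p^m + 1. *)
Lemma fam_orbit_pow_le m n :
  mcg_orbit (fam_pt (iota (p%:R ^- n))) (fam_pt (iota (p%:R ^- m))) -> (n <= m)%N.
Proof.
have gt0 k : 0 < iota (p%:R ^- k).
  by rewrite fmorphV rmorphXn rmorph_nat invr_gt0 exprn_gt0 // ltr0n prime_gt0.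
move=> /(fam_orbit (gt0 n)) [_ [_ [h [_ _ E]]]].
have gn0 : (p%:R ^- n : K) != 0 by rewrite invr_eq0 expf_neq0.
have Lg := inverted_prime_powV n.
have LV : inverted_prime (p%:R ^- n)^-1 by rewrite invrK; apply: inverted_prime_pow.
have [l [j [k hl]] El] := fam_rep_congr1 inverted_prime_subring Lg LV gn0 h.
have {E} : (2 + p%:R ^- m) ^+ 2 = - ((2 + p%:R ^- n) ^+ 2 * l) :> K.
  apply: (fmorph_inj iota); have h2 : iota 2 = 2 by rewrite rmorph_nat.
  have h3 : iota (2 + p%:R ^- m) = 2 + iota (p%:R ^- m) by rewrite rmorphD h2.
  rewrite rmorphXn h3; move: E; rewrite El rmorphD h2 rmorphN => E.
  by apply: (eq_combination (k := -1) E); ring.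
move=> E.
have [pm pn] : p%:R ^+ m != 0 :> K /\ p%:R ^+ n != 0 :> K by rewrite !expf_neq0.
have E2 : (2 * p%:R ^+ m + 1) ^+ 2 * (p%:R ^+ n) ^+ 2 * p%:R ^+ j =
    - ((2 * p%:R ^+ n + 1) ^+ 2 * (p%:R ^+ m) ^+ 2 * k%:~R) :> K.
  rewrite -hl.
  have -> : 2 * p%:R ^+ m + 1 = (2 + p%:R ^- m) * p%:R ^+ m :> K by field.
  have -> : 2 * p%:R ^+ n + 1 = (2 + p%:R ^- n) * p%:R ^+ n :> K by field.
  by rewrite exprMn E; ring.
have E3 : (2 * p%:Z ^+ m + 1) ^+ 2 * (p%:Z ^+ n) ^+ 2 * p%:Z ^+ j =
    - ((2 * p%:Z ^+ n + 1) ^+ 2 * (p%:Z ^+ m) ^+ 2 * k).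
  apply: (fext_int_inj iota); move: E2.
  by rewrite /= !(rmorphN, rmorphM, rmorphXn, rmorphD) /=.
(* The case n = 0 is trivial and is set apart because 2p^0 + 1 = 3 need not be prime to p. *)
have [->//|n0] := posnP n.
pose N := ((2 * p ^ n + 1) ^ 2)%N; pose M := ((2 * p ^ m + 1) ^ 2)%N.
have pgt0 := prime_gt0 p_prime.
have dv : (N %| M * (p ^ (n * 2) * p ^ j))%N.
  have := congr1 absz E3; rewrite abszN !abszM !abszX.
  have AE a : `|(2 * p%:Z ^+ a + 1)%R|%N = (2 * p ^ a + 1)%N.
    by rewrite (_ : p%:Z ^+ a = (p ^ a)%N%:Z); [lia|rewrite -!natz natrX].
  rewrite !AE !absz_nat => E4.
  have -> : (M * (p ^ (n * 2) * p ^ j) = N * (p ^ m * p ^ m * `|k|))%N.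
    by rewrite /M /N expnM -!mulnn !mulnA -!mulnA !mulnA in E4 *.
  exact: dvdn_mulr.
have cop : coprime N (p ^ (n * 2) * p ^ j).
  rewrite -expnD coprimeXl // coprimeXr //.
  case: n n0 {N dv E E2 E3 gn0 Lg LV El pn} => // n _.
  by rewrite coprime_sym expnSr mulnA /coprime gcdnMDl gcdn1.
move: dv; rewrite Gauss_dvdl // => /dvdn_leq; rewrite expn_gt0 addn1 => /(_ isT).
by rewrite /N /M leq_exp2r // leq_add2r leq_pmul2l // leq_exp2l // prime_gt1.
Qed.

Lemma infinite_orbits_inverted_prime (S : set (finite_place K)) v : S v -> 0 < v p%:R ->
  ~ finite_set [set mcg_orbit q | q in @teichmuller R `&` S_integral_points iota S
                                     `&` [set q | trace_field q = range iota]].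
Proof.
move=> Sv vp fin.
have gt0 k : 0 < iota (p%:R ^- k).
  by rewrite fmorphV rmorphXn rmorph_nat invr_gt0 exprn_gt0 // ltr0n prime_gt0.
pose f n := mcg_orbit (fam_pt (iota (p%:R ^- n))).
have [m hm] : exists m, forall b, exists2 n, (b <= n)%N & f n = f m.
  apply: infinite_fiber; apply: sub_finite_set fin => _ [n _ <-].
  exists (fam_pt (iota (p%:R ^- n))) => //; split; first split.
  - exact: fam_pt_teichmuller.
  - apply: fam_pt_S_integral; apply: (inverted_prime_S_integers Sv vp).
      exact: inverted_prime_powV.
    by rewrite invrK; apply: inverted_prime_pow.
  - apply: fam_trace_field => // x; have [r ->] := rational_elt KQ x.
    by exists r%:P; rewrite map_polyC hornerC.
(* The orbit for [m] recurs at some [n > m], which [fam_orbit_pow_le] excludes. *)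
have [n mn fE] := hm m.+1; have := @fam_orbit_pow_le m n.
rewrite -[mcg_orbit (fam_pt (iota (p%:R ^- n)))]/(f n) fE leqNgt mn => H.
have // : false; apply: H; apply: mcg_orbit_refl.
  by have [] := fam_pt_teichmuller (gt0 m).
exact: fam_pt_neq2.
Qed.

End InvertedPrime.

(** * The multiplier ring *)

Section DetBounds.

(** Expansion along the changed row uses the cofactors of [A], and the product of [A] with its
    adjugate leaves only the term of [c i0]. A row of a multiplication matrix can thus be traded for
    a multiple of an eigenvector. *)
Lemma det_row_combination (F : comPzRingType) n (A B : 'M[F]_n) (i0 : 'I_n) (c : 'I_n -> F) :
  (forall i j, i != i0 -> B i j = A i j) ->
  (forall j, B i0 j = \sum_k c k * A k j) -> \det B = c i0 * \det A.
Proof.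
move=> hB hB0; rewrite (expand_det_row _ i0).
have cof j : cofactor B i0 j = cofactor A i0 j.
  rewrite /cofactor; congr (_ * \det _); apply/matrixP => i k.
  by rewrite !mxE hB // eq_sym neq_lift.
transitivity (\sum_k c k * (A *m \adj A) k i0).
  under eq_bigr => j _ do rewrite hB0 cof mulr_suml.
  rewrite exchange_big; apply: eq_bigr => k _ /=.
  by rewrite !mxE mulr_sumr; apply: eq_bigr => j _; rewrite !mxE mulrA.
rewrite mul_mx_adj (bigD1 i0) //= big1 ?addr0 => [|k ki].
  by rewrite !mxE eqxx mulr1n.
by rewrite !mxE (negPf ki) mulr0n mulr0.
Qed.

Lemma det_norm_le (F : realDomainType) n (B : 'M[F]_n) (r : 'I_n -> F) :
  (forall i j, `|B i j| <= r i) -> `|\det B| <= n`!%:R * \prod_i r i.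
Proof.
move=> h; rewrite /determinant.
apply: le_trans (ler_norm_sum _ _ _) _.
apply: (@le_trans _ _ (\sum_(s : 'S_n) \prod_i r i)).
  apply: ler_sum => s _; rewrite normrM normrX normrN1 expr1n mul1r normr_prod.
  by apply: ler_prod => i _; rewrite normr_ge0 h.
by rewrite sumr_const card_Sn mulr_natl.
Qed.

End DetBounds.

Section MultiplicationMatrix.
Variable K : fieldExtType rat.
Let d := \dim {:K}.

Definition fbasis (i : 'I_d) : K := (vbasis {:K})`_i.

Lemma fbasis_sum (x : K) : x = \sum_i coord (vbasis {:K}) i x *: fbasis i.
Proof. exact: coord_vbasis (memvf x). Qed.

Lemma fbasis_coord (c : 'I_d -> rat) k :
  coord (vbasis {:K}) k (\sum_i c i *: fbasis i) = c k.
Proof. exact: coord_sum_free (basis_free (vbasisP _)). Qed.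

Lemma fbasis_neq0 i : fbasis i != 0.
Proof.
apply/eqP => h; have := fbasis_coord (fun j => (j == i)%:R) i.
rewrite (bigD1 i) //= big1 => [|j ji]; last by rewrite (negPf ji) scale0r.
by rewrite h scaler0 addr0 linear0 eqxx => /esym /eqP; rewrite oner_eq0.
Qed.

Definition mulmat (x : K) : 'M[rat]_d := \matrix_(i, j) coord (vbasis {:K}) j (fbasis i * x).

Lemma mulmatE x i : fbasis i * x = \sum_j mulmat x i j *: fbasis j.
Proof. by rewrite {1}[_ * x]fbasis_sum; apply: eq_bigr => j _; rewrite mxE. Qed.

Lemma mulmat_uniq x (A : 'M[rat]_d) :
  (forall i, fbasis i * x = \sum_j A i j *: fbasis j) -> mulmat x = A.
Proof. by move=> h; apply/matrixP => i j; rewrite mxE h fbasis_coord. Qed.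

Lemma mulmatD x y : mulmat (x + y) = mulmat x + mulmat y.
Proof.
apply: mulmat_uniq => i; rewrite mulrDr !mulmatE -big_split; apply: eq_bigr => j _ /=.
by rewrite [in RHS]mxE scalerDl.
Qed.

Lemma mulmatZ a x : mulmat (a *: x) = a *: mulmat x.
Proof.
apply: mulmat_uniq => i; rewrite -scalerAr mulmatE scaler_sumr; apply: eq_bigr => j _.
by rewrite [in RHS]mxE scalerA.
Qed.

Lemma mulmat1 : mulmat 1 = 1%:M.
Proof.
apply: mulmat_uniq => i; rewrite mulr1 (bigD1 i) //= big1 ?addr0 => [|j ji].
  by rewrite mxE eqxx scale1r.
by rewrite mxE eq_sym (negPf ji) scale0r.
Qed.

Lemma mulmatM x y : mulmat (x * y) = mulmat x *m mulmat y.
Proof.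
apply: mulmat_uniq => i; rewrite mulrA mulmatE mulr_suml.
under eq_bigr => j _ do rewrite -scalerAl mulmatE scaler_sumr.
rewrite exchange_big; apply: eq_bigr => k _ /=.
by rewrite mxE scaler_suml; apply: eq_bigr => j _; rewrite scalerA.
Qed.

Lemma mulmat0 : mulmat 0 = 0.
Proof. by rewrite -(scale0r 0) mulmatZ scale0r. Qed.

Lemma mulmatN x : mulmat (- x) = - mulmat x.
Proof. by rewrite -scaleN1r mulmatZ scaleN1r. Qed.

Lemma mulmat_sum (I : finType) (f : I -> K) : mulmat (\sum_i f i) = \sum_i mulmat (f i).
Proof. exact: (big_morph mulmat mulmatD mulmat0). Qed.

Lemma mulmat_unit x : x != 0 -> mulmat x \in unitmx.
Proof.
move=> x0; case: (mulmx1_unit (A := mulmat x) (B := mulmat x^-1)) => //.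
by rewrite -mulmatM mulfV // mulmat1.
Qed.

Lemma mulmatV x : x != 0 -> mulmat x^-1 = invmx (mulmat x).
Proof.
move=> x0; apply: (can_inj (mulKmx (mulmat_unit x0))).
by rewrite -mulmatM mulfV // mulmat1 mulmxV // mulmat_unit.
Qed.

Definition fnorm x : rat := \det (mulmat x).

Lemma fnorm_neq0 x : x != 0 -> fnorm x != 0.
Proof. by move=> /mulmat_unit; rewrite unitmxE unitfE. Qed.

(* The multiplier ring of the lattice spanned by [fbasis]. *)
Definition mult_order (x : K) : Prop := exists A : 'M[int]_d, mulmat x = map_mx intr A.

Lemma order_subring : subring mult_order.
Proof.
split.
- by exists 1%:M; rewrite map_mx1 mulmat1.
- by move=> x y [A hA] [B hB]; exists (A - B); rewrite mulmatD mulmatN hA hB map_mxB.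
- by move=> x y [A hA] [B hB]; exists (A *m B); rewrite mulmatM hA hB map_mxM.
Qed.

Lemma order_fnorm x : mult_order x -> exists n : int, fnorm x = n%:~R.
Proof. by move=> [A hA]; exists (\det A); rewrite /fnorm hA det_map_mx. Qed.

(** The matrix of norm(x)/x is the adjugate of the matrix of x, and the adjugate of an integer
    matrix is integral. *)
Lemma order_norm_div x : x != 0 -> mult_order x -> mult_order ((fnorm x)%:A / x).
Proof.
move=> x0 [A hA]; exists (\adj A); rewrite map_mx_adj -hA.
rewrite -scalerAl mul1r mulmatZ mulmatV // /invmx mulmat_unit //.
by rewrite scalerA mulfV ?fnorm_neq0 // scale1r.
Qed.

Lemma order_multiple x : exists2 m : int, m != 0 & mult_order (m%:~R *: x).
Proof.
pose D (i j : 'I_d) := denq (mulmat x i j).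
exists (\prod_i \prod_j D i j).
  by apply/prodf_neq0 => i _; apply/prodf_neq0 => j _; apply: denq_neq0.
set m := \prod_i _; exists (\matrix_(i, j) numq (m%:~R * mulmat x i j)).
rewrite mulmatZ; apply/matrixP => i j; rewrite mxE [RHS]mxE [in RHS]mxE.
have [k ->] : exists k, m = k * D i j.
  by eexists; rewrite /m (bigD1 i) //= (bigD1 j) //= mulrC mulrCA mulrC.
by rewrite rmorphM /= -mulrA [D i j]/(denq _) mulrC (mulrC _%:~R) -numqE -rmorphM numq_int.
Qed.

(** Suitable integer multiples of the basis of K lie in the order; their integer combinations feed
    the pigeonhole argument. *)
Lemma order_basis : exists2 w : 'I_d -> K, forall i, mult_order (w i) &
  forall c : 'I_d -> int, \sum_i (c i)%:~R * w i = 0 -> forall i, c i = 0.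
Proof.
have /choice [m hm] : forall i : 'I_d, exists m : int, m != 0 /\ mult_order (m%:~R *: fbasis i).
  by move=> i; have [m m0 hm] := order_multiple (fbasis i); exists m.
exists (fun i => (m i)%:~R *: fbasis i); first by move=> i; have [] := hm i.
move=> c h i; have := fbasis_coord (fun i => (c i * m i)%:~R) i.
have -> : \sum_j ((c j * m j)%:~R : rat) *: fbasis j = 0.
  rewrite -[RHS]h; apply: eq_bigr => j _; rewrite rmorphM -scalerA.
  by rewrite -[in RHS](rmorph_int (in_alg K)) mulr_algl.
rewrite linear0 => /esym /eqP; rewrite intr_eq0 mulf_eq0.
by have [/negPf ->] := hm i; rewrite orbF => _ /eqP.
Qed.

Lemma fbasis_dim_gt0 : (0 < d)%N.
Proof.
rewrite lt0n dimv_eq0 -subv0; apply: contraTN (memvf (1 : K)) => /subvP h.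
by apply/negP => /h; rewrite memv0 oner_eq0.
Qed.

(** For a basis element of least value, the product with [x] is an integral combination of the
    basis, so its value is no smaller. *)
Lemma order_place v x : mult_order x -> 0 <= (v : finite_place K) x.
Proof.
move=> [A hA]; have [->|x0] := eqVneq x 0; first by rewrite val_at0.
have [i hi] : exists i, forall j, v (fbasis i) <= v (fbasis j).
  case: (@Order.TotalTheory.arg_minP _ _ _ (Ordinal fbasis_dim_gt0) xpredT
    (fun i => v (fbasis i))) => // i _ hi.
  by exists i => j; apply: hi.
have : fbasis i * x = 0 \/ v (fbasis i) <= v (fbasis i * x).
  rewrite mulmatE; elim/big_ind: _ => [|y z|j _]; first by left.
    exact: place_geD.
  rewrite hA mxE -mulr_algl -[_%:A]/(in_alg K _) rmorph_int.
  have [->|a0] := eqVneq ((A i j)%:~R : K) 0; first by left; rewrite mul0r.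
  right; rewrite val_atM ?fbasis_neq0 //.
  by have := place_int v (A i j); have := hi j; move: (v _) (v _) (v _) => a b c; lia.
case=> [/eqP|]; first by rewrite mulf_eq0 (negPf x0) (negPf (fbasis_neq0 i)).
by rewrite val_atM ?fbasis_neq0 // lerDl.
Qed.

Definition generates (e : K) : Prop :=
  forall x : K, exists p : {poly rat}, x = (map_poly (in_alg K) p).[e].

(* A complement of Q(e) in K as a Q(e)-vector space provides psi. *)
Lemma nongenerating_endo (e : K) : ~ generates e -> exists psi : K -> K,
  [/\ forall x y, psi (x + y) = psi x + psi y,
      forall (r : rat) x, psi (r *: x) = r *: psi x,
      forall x, psi (x * e) = psi x * e, psi 1 = 0 & exists x, psi x != 0].
Proof.
move=> /existsNP [x hx].
pose F : {subfield K} := <<1; e>>%AS.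
pose L := fieldOver F.
have eF : e \in F by apply: memv_adjoin.
have xF : x \notin F.
  apply/negP => /Fadjoin_polyP [p /polyOver1P [q hq] hp].
  by apply: hx; exists q; rewrite hp hq.
(* Over [F] the subspace [1%VS] is [F] itself, so [psi] is F-linear, kills [F] and is nonzero at
   [x]. *)
pose U : {vspace L} := 1%VS.
pose psi (y : K) : K := (y : L) - projv U (y : L).
have psiD y z : psi (y + z) = psi y + psi z.
  by rewrite /psi linearD opprD addrACA.
have psiZ (a : subvs_of F) y : psi (vsval a * y) = vsval a * psi y.
  by rewrite /psi -!fieldOver_scaleE linearZ -scalerBr.
exists psi; split=> //.
- move=> r y; have rF : r%:A \in F by rewrite memvZ // mem1v.
  have := psiZ (Subvs rF) y; rewrite /= !mulr_algl => ->.
  by [].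
- by move=> y; rewrite mulrC (psiZ (Subvs eF)) /= mulrC.
- by rewrite /psi projv_id ?subrr // mem1v.
- exists x; rewrite subr_eq0; apply: contra xF => /eqP h.
  by have := memv_proj U (x : L); rewrite -h trivial_fieldOver.
Qed.

End MultiplicationMatrix.

(** * Units *)

Section EigenBounds.
Variables (R : realType) (K : fieldExtType rat) (iota : {rmorphism K -> R}).
Let d := \dim {:K}.
Let V (i : 'I_d) : R := iota (fbasis i).
Let Vmax : R := \sum_i `|V i|.

Lemma iota_scale (r : rat) x : iota (r *: x) = ratr r * iota x.
Proof. by rewrite -mulr_algl rmorphM iota_rat. Qed.

(** A rational linear map commuting with multiplication by [x] yields, through [iota], a vector
    satisfying the eigenvector equation of the multiplication matrix for [iota x]; the identity map
    gives [V]. *)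
Lemma iota_eigen (psi : K -> K) x : (forall y z, psi (y + z) = psi y + psi z) ->
  (forall (r : rat) y, psi (r *: y) = r *: psi y) ->
  (forall y, psi (y * x) = psi y * x) -> forall i,
  iota x * iota (psi (fbasis i)) =
    \sum_j ratr (mulmat x i j) * iota (psi (fbasis j)).
Proof.
move=> psiD psiZ psiM i; rewrite mulrC -rmorphM -psiM mulmatE.
have psi0 : psi 0 = 0 by rewrite -(scale0r 0) psiZ !scale0r.
rewrite (big_morph psi psiD psi0) rmorph_sum; apply: eq_bigr => j _ /=.
by rewrite psiZ iota_scale.
Qed.

(** Transposed, so that the eigenvector relation becomes one between rows: their combination with
    coefficients [V] equals [iota x] times [V]. *)
Let realmat x : 'M[R]_d := (map_mx (@ratr R) (mulmat x))^T.

Let realmatE x i j : realmat x i j = ratr (mulmat x j i).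
Proof. by rewrite !mxE. Qed.

Let rowrep x i0 : 'M[R]_d :=
  \matrix_(i, j) if i == i0 then iota x * V j else realmat x i j.

Let rowrep_det x i0 : \det (rowrep x i0) = V i0 * ratr (fnorm x).
Proof.
rewrite (det_row_combination (A := realmat x) (i0 := i0) (c := V)).
- by rewrite det_tr det_map_mx.
- by move=> i j ij; rewrite mxE (negPf ij).
- move=> j; rewrite mxE eqxx (iota_eigen (psi := id)) //.
  by apply: eq_bigr => k _; rewrite mulrC !mxE.
Qed.

Let V_le i : `|V i| <= Vmax.
Proof. by rewrite /Vmax (bigD1 i) //= lerDl sumr_ge0. Qed.

(** One row of the matrix is replaced by [iota x] times [V], which brings the factor [|iota x|] into
    the bound on the determinant. *)
Lemma fnorm_bound x (C : R) i0 : (forall i j, `|ratr (mulmat x i j)| <= C) ->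
  `|V i0| * `|ratr (fnorm x)| <= d`!%:R * (`|iota x| * Vmax * C ^+ d.-1).
Proof.
move=> hC; rewrite -normrM -rowrep_det.
apply: le_trans (det_norm_le (r := fun i => if i == i0 then `|iota x| * Vmax else C) _) _.
  move=> i j; rewrite mxE; case: eqP => _; last by rewrite realmatE hC.
  by rewrite normrM ler_wpM2l.
rewrite (bigD1 i0) //= eqxx ler_wpM2l // ler_wpM2l //.
  by rewrite mulr_ge0 // sumr_ge0.
rewrite (eq_bigr (fun=> C)) => [|i /negPf -> //].
by rewrite prodr_const cardC1 card_ord.
Qed.

(* A non-generating unit has a second eigenvector, hence |iota x| occurs
   twice in the bound on its norm. *)
Lemma nongenerating_unit_bound x (C : R) i0 : (forall i j, `|ratr (mulmat x i j)| <= C) ->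
  `|fnorm x| = 1 -> ~ generates x ->
  `|V i0| <= d`!%:R * (`|iota x| * Vmax * `|iota x| * C ^+ d.-2).
Proof.
move=> hC hN /nongenerating_endo [psi [psiD psiZ psiM psi1 [y psiy]]].
have V0 : V i0 != 0 by rewrite fmorph_eq0 fbasis_neq0.
pose w0 i := iota (psi (fbasis i)); pose t := w0 i0 / V i0.
(* Subtracting a multiple of [V] makes the second eigenvector vanish at [i0], so that its relation
   between rows does not involve row [i0], already replaced. *)
pose w1 i := w0 i - t * V i.
have w1e i : iota x * w1 i = \sum_j ratr (mulmat x i j) * w1 j.
  rewrite /w1 mulrBr (iota_eigen psiD psiZ psiM) mulrCA.
  rewrite (iota_eigen (psi := id)) // mulr_sumr -sumrB.
  by apply: eq_bigr => j _; rewrite mulrBr mulrCA.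
(* Dividing by the largest entry bounds [W] by 1 and makes the coefficient of row [j] equal to 1, so
   replacing that row keeps the determinant. *)
have [j hj] : exists j, forall i, `|w1 i| <= `|w1 j|.
  case: (@Order.TotalTheory.arg_maxP _ _ _ i0 xpredT (fun i => `|w1 i|)) => // j _ h.
  by exists j => i; apply: h.
have w1j : w1 j != 0.
  (* If [w1] vanished, [psi] would become multiplication by [t] under [iota], and [psi 1 = 0] would
     force [psi = 0]. *)
  apply/negP => /eqP w1j; have w10 i : w1 i = 0.
    by apply/eqP; rewrite -normr_le0 (le_trans (hj i)) // w1j normr0.
  have psi0 : psi 0 = 0 by rewrite -(scale0r 0) psiZ !scale0r.
  have E z : iota (psi z) = t * iota z.
    rewrite {1}[z]fbasis_sum (big_morph psi psiD psi0) rmorph_sum {2}[z]fbasis_sum.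
    rewrite rmorph_sum mulr_sumr; apply: eq_bigr => i _ /=.
    rewrite psiZ !iota_scale mulrCA; congr (_ * _); apply/eqP.
    by rewrite -subr_eq0 -/(w0 i) -/(V i) -/(w1 i) w10.
  have t0 : t = 0 by have := E 1; rewrite psi1 rmorph0 rmorph1 mulr1.
  by move: psiy; rewrite -(fmorph_eq0 iota) E t0 mul0r eqxx.
have w1i0 : w1 i0 = 0 by rewrite /w1 /t divfK // subrr.
have ji0 : j != i0 by apply: contraNneq w1j => ->; rewrite w1i0.
pose W i := w1 i / w1 j.
have We i : iota x * W i = \sum_j ratr (mulmat x i j) * W j.
  by rewrite /W mulrA w1e mulr_suml; apply: eq_bigr => k _; rewrite mulrA.
have W1 i : `|W i| <= 1.
  by rewrite /W normrM normfV ler_pdivrMr ?normr_gt0 // mul1r.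
pose B : 'M[R]_d := \matrix_(i, k) if i == j then iota x * W k else rowrep x i0 i k.
have detB : \det B = V i0 * ratr (fnorm x).
  rewrite -rowrep_det (det_row_combination (A := rowrep x i0) (i0 := j) (c := W)).
  - by rewrite /W divff // mul1r.
  - by move=> i k ij; rewrite mxE (negPf ij).
  - move=> k; rewrite mxE eqxx We; apply: eq_bigr => l _; rewrite [RHS]mulrC [in RHS]mxE realmatE.
    by case: eqP => // ->; rewrite /W w1i0 mul0r !mulr0.
have -> : `|V i0| = `|\det B|.
  rewrite detB normrM -[X in _ * X]ratr_norm.
  by rewrite hN rmorph1 mulr1.
apply: le_trans (det_norm_le (r := fun i => if i == j then `|iota x|
  else if i == i0 then `|iota x| * Vmax else C) _) _.
  move=> i k; rewrite mxE; case: eqP => _.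
    by rewrite normrM ler_piMr.
  by rewrite mxE; case: eqP => _; [rewrite normrM ler_wpM2l|rewrite realmatE hC].
rewrite (bigD1 j) //= eqxx (bigD1 i0) /=; last by rewrite eq_sym.
rewrite eqxx eq_sym (negPf ji0) ler_wpM2l //.
rewrite (eq_bigr (fun=> C)) => [|i /andP [/negPf -> /negPf -> //]].
rewrite prodr_const mulrA [X in _ <= X * _]mulrC.
have -> : #|(fun i : 'I_d => (i != j) && (i != i0))| = d.-2.
  have := cardD1 i0 (predC1 j); rewrite cardC1 card_ord !inE eq_sym ji0 => ->.
  by rewrite add1n /=; apply: eq_card => i; rewrite !inE andbC.
by [].
Qed.

End EigenBounds.

(** * Small values of linear forms by the pigeonhole principle *)

Section Pigeonhole.
Variable R : realType.

(** There are (T + 1)^n coefficient vectors with entries from 0 to T, but only T^n boxes in an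
    interval of length 2 c0 T containing the values of the form. Two vectors in one box have values
    at distance at most 2 c0 / T^(n - 1). *)
Lemma dirichlet_pigeonhole n (w : 'I_n -> R) : (0 < n)%N -> exists2 C : R, 0 < C &
  forall T : nat, (0 < T)%N -> exists c : 'I_n -> int,
  [/\ exists i, c i != 0, forall i, `|c i| <= T%:Z &
      `|\sum_i (c i)%:~R * w i| * T%:R ^+ n.-1 <= C].
Proof.
case: n w => // d w _.
pose c0 : R := \sum_i `|w i| + 1.
have c00 : 0 < c0 by rewrite ltr_wpDl // sumr_ge0.
exists (2 * c0); first by rewrite mulr_gt0.
move=> T T0; have T0R : 0 < T%:R :> R by rewrite ltr0n.
pose lin (f : {ffun 'I_d.+1 -> 'I_T.+1}) : R := \sum_i (f i)%:R * w i.
have lin_lt f : `|lin f| < c0 * T%:R.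
  apply: (@le_lt_trans _ _ (\sum_i T%:R * `|w i|)).
    apply: le_trans (ler_norm_sum _ _ _) _; apply: ler_sum => i _.
    by rewrite normrM normr_nat ler_wpM2r // ler_nat -ltnS.
  by rewrite -mulr_sumr mulrC ltr_pM2r // /c0 ltrDl.
(* The value of the form is rescaled to lie between 0 and [T ^ d.+1]; its truncation is the index of
   the box. *)
pose u f : R := (lin f + c0 * T%:R) / (2 * c0 * T%:R) * T%:R ^+ d.+1.
have u0 f : 0 <= u f.
  have := lin_lt f; rewrite ltr_norml => /andP [h _].
  by rewrite mulr_ge0 ?exprn_ge0 ?ltW // divr_gt0 ?mulr_gt0 // -ltrBlDr sub0r.
have u1 f : (Num.truncn (u f) < T ^ d.+1)%N.
  have := lin_lt f; rewrite ltr_norml => /andP [_ h].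
  rewrite -(ltr_nat R); have /andP [h1 _] := truncn_itv (u0 f).
  apply: le_lt_trans h1 _; rewrite natrX /u gtr_pMl ?exprn_gt0 //.
  rewrite ltr_pdivrMr ?mulr_gt0 // mul1r -mulrA mulr_natl mulr2n.
  by rewrite ltrD2r.
pose box f : 'I_(T ^ d.+1) := Ordinal (u1 f).
have [f [g [fg Efg]]] : exists f g, f != g /\ box f = box g.
  have : ~ injective box.
    move=> /leq_card; rewrite card_ffun !card_ord leqNgt ltn_exp2r // ltnSn //.
  move=> /existsNP [f /existsNP [g /not_implyP [h1 h2]]].
  by exists f, g; split=> //; apply/eqP.
exists (fun i => (f i)%:Z - (g i)%:Z); split.
- apply: contrapT => /forallNP h; move: fg => /negP; apply; apply/eqP/ffunP => i.
  by have := h i; move/negP; rewrite negbK subr_eq0 eqz_nat => /eqP /val_inj.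
- by move=> i; have := ltn_ord (f i); have := ltn_ord (g i); lia.
- have -> : \sum_i ((f i)%:Z - (g i)%:Z)%:~R * w i = lin f - lin g.
    rewrite /lin -sumrB; apply: eq_bigr => i _.
    by rewrite rmorphB mulrBl.
  have E : (lin f - lin g) * T%:R ^+ d = 2 * c0 * (u f - u g).
    by rewrite /u exprSr; field; rewrite !gt_eqF.
  have Td : `|T%:R ^+ d| = T%:R ^+ d :> R by rewrite ger0_norm // exprn_ge0 // ltW.
  rewrite -[X in _ * X]Td -normrM E normrM gtr0_norm ?mulr_gt0 //.
  rewrite ler_piMr ?mulr_ge0 ?ltW //.
  have /andP [f1 f2] := truncn_itv (u0 f); have /andP [g1 g2] := truncn_itv (u0 g).
  have EE : Num.truncn (u f) = Num.truncn (u g) := congr1 (@nat_of_ord _) Efg.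
  rewrite EE -natr1 in f1 f2; rewrite -natr1 in g2.
  by rewrite ltr_norml; lra.
Qed.

End Pigeonhole.

(** * Units congruent to integers modulo m *)

Section UnitsModulo.
Variables (R : realType) (K : fieldExtType rat) (iota : {rmorphism K -> R}).

(** The ring Z + m O, for O the multiplier ring. *)
Definition order_mod (m : nat) (x : K) : Prop :=
  exists (k : int) (u : K), mult_order u /\ x = k%:~R + m%:R * u.

Lemma order_mod_subring m : subring (order_mod m).
Proof.
have hO := order_subring K; split.
- by exists 1, 0; split; [exact: subring0|rewrite mulr0 addr0].
- move=> _ _ [k [u [hu ->]]] [l [v [hv ->]]]; exists (k - l), (u - v).
  by split; [exact: subringB|rewrite rmorphB /=; ring].
- move=> _ _ [k [u [hu ->]]] [l [v [hv ->]]].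
  exists (k * l), (k%:~R * v + u * l%:~R + u * (m%:R * v)); split; last by rewrite rmorphM /=; ring.
  apply: (subringD hO); first apply: (subringD hO).
  + by apply: (subringM hO) => //; apply: (subring_int hO).
  + by apply: (subringM hO) => //; apply: (subring_int hO).
  + by apply: (subringM hO) => //; apply: (subringM hO) => //; apply: (subring_nat hO).
Qed.

Lemma order_mod_order m x : order_mod m x -> mult_order x.
Proof.
have hO := order_subring K; move=> [k [u [hu ->]]].
apply: (subringD hO); first exact: (subring_int hO).
by apply: (subringM hO) => //; apply: (subring_nat hO).
Qed.

(** Here x / y = 1 + m b! z / y. The norm n of y divides b!, and n / y lies in the order, hence so
    does b! z / y. *)
Lemma order_mod_quotient m b (n : int) x y z : y != 0 -> mult_order y -> mult_order z ->
  fnorm y = n%:~R -> (`|n| <= b)%N -> x = y + (m * b`!)%:R * z ->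
  order_mod m (x / y).
Proof.
move=> y0 hy hz hn nb ->; have hO := order_subring K.
have n0 : n != 0 by rewrite -(intr_eq0 rat) -hn fnorm_neq0.
have /dvdnP [c hc] : (`|n| %| b`!)%N by rewrite dvdn_fact // absz_gt0 n0.
exists 1, (c%:R * ((sgz n)%:~R * ((fnorm y)%:A / y) * z)); split.
  apply: (subringM hO); first exact: (subring_nat hO).
  apply: (subringM hO) => //; apply: (subringM hO); first exact: (subring_int hO).
  exact: order_norm_div.
have -> : (m * b`!)%:R = m%:R * c%:R * ((sgz n)%:~R * n%:~R) :> K.
  by rewrite -intrM -abszEsg hc mulnA !natrM.
have -> : (fnorm y)%:A = n%:~R :> K by rewrite hn -[_%:A]/(in_alg K _) rmorph_int.
by field.
Qed.

Let d := \dim {:K}.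

Lemma units_modulo (m : nat) : (1 < d)%N -> (0 < m)%N -> exists e : K,
  [/\ 0 < iota e, order_mod m e, order_mod m e^-1 & generates e].
Proof.
move=> d1 m0; have hO := order_subring K.
have d0 : (0 < d)%N by apply: ltn_trans d1.
pose i0 : 'I_d := Ordinal d0.
have [w hw wfree] := order_basis K.
pose xs (c : 'I_d -> int) : K := \sum_i (c i)%:~R * w i.
have xs_order c : mult_order (xs c).
  by apply: (subring_sum hO) => i _; apply: (subringM hO) => //; apply: (subring_int hO).
have [C C0 hC] : exists2 C : R, 0 < C &
  forall T : nat, (0 < T)%N -> exists c : 'I_d -> int,
  [/\ exists i, c i != 0, forall i, `|c i| <= T%:Z &
      `|iota (xs c)| * T%:R ^+ d.-1 <= C].
  have [C C0 hC] := dirichlet_pigeonhole (fun i => iota (w i)) d0.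
  exists C => // T T0; have [c [h1 h2 h3]] := hC T T0; exists c; split=> //.
  rewrite /xs rmorph_sum; under eq_bigr => i _ do rewrite rmorphM rmorph_int.
  exact: h3.
have /choice [c hc] : forall T : nat, exists c : 'I_d -> int,
  [/\ exists i, c i != 0, forall i, `|c i| <= T.+1%:Z &
      `|iota (xs c)| * T.+1%:R ^+ d.-1 <= C] by move=> T; apply: hC.
have xs0 T : xs (c T) != 0.
  apply/eqP => /wfree h; have [[i /eqP hi] _ _] := hc T; exact: hi (h i).
pose C1 : R := \sum_k \sum_i \sum_j `|ratr (mulmat (w k) i j)|.
have C1_ge0 : 0 <= C1 by do 3!(apply: sumr_ge0 => ? _).
have entries T i j : `|ratr (mulmat (xs (c T)) i j) : R| <= C1 * T.+1%:R.
  have -> : mulmat (xs (c T)) i j = \sum_k (c T k)%:~R * mulmat (w k) i j.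
    rewrite mulmat_sum summxE; apply: eq_bigr => k _.
    by rewrite -[_%:~R](rmorph_int (in_alg K)) mulr_algl mulmatZ mxE.
  rewrite rmorph_sum (le_trans (ler_norm_sum _ _ _)) // /C1 mulr_suml.
  apply: ler_sum => k _; rewrite rmorphM /= ratr_int normrM mulrC.
  apply: ler_pM => //; last first.
    have [_ h _] := hc T.
    by rewrite -intr_norm -[T.+1%:R]/(T.+1%:Z%:~R) ler_int h.
  by rewrite (bigD1 i) //= (bigD1 j) //= -addrA lerDl addr_ge0 //; do 2?(apply: sumr_ge0 => ? _).
pose V0 : R := `|iota (fbasis i0)|; pose Vm : R := \sum_(i < d) `|iota (fbasis i)|.
have V0_gt0 : 0 < V0 by rewrite normr_gt0 fmorph_eq0 fbasis_neq0.
have Vm_ge0 : 0 <= Vm by apply: sumr_ge0.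
(* This bound on the norm is uniform in [T]: the matrix entries contribute (C1 (T + 1))^(d - 1), and
   [|iota (xs (c T))|] is at most C / (T + 1)^(d - 1). *)
pose b := (Num.truncn (d`!%:R * (C * Vm * C1 ^+ d.-1) / V0)).+1.
have norm_le T : exists2 n : int, fnorm (xs (c T)) = n%:~R & (`|n| <= b)%N.
  have [n hn] := order_fnorm (xs_order (c T)); exists n => //.
  have := fnorm_bound iota i0 (entries T); rewrite -/V0 -/Vm hn ratr_int -intr_norm.
  rewrite exprMn => h.
  have h2 : `|n|%:~R <= d`!%:R * (C * Vm * C1 ^+ d.-1) / V0 :> R.
    rewrite ler_pdivlMr // mulrC (le_trans h) // ler_wpM2l //.
    have [_ _ h3] := hc T; set D := C1 ^+ d.-1; set E := _ ^+ d.-1 in h3 *.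
    have -> : `|iota (xs (c T))| * Vm * (D * E) = `|iota (xs (c T))| * E * (Vm * D) by ring.
    by rewrite -[X in _ <= X]mulrA ler_wpM2r // mulr_ge0 // exprn_ge0.
  set X := _ / V0 in h2 *; have X0 : 0 <= X by apply: le_trans h2; rewrite ler0z.
  have /andP [_ h4] := truncn_itv X0; have h5 := le_lt_trans h2 h4.
  have -> : b = (Num.truncn X).+1 by [].
  by move: h5; rewrite -[_.+1%:R]/((Num.truncn X).+1%:Z%:~R) ltr_int; lia.
pose q := (m * b`!)%N; have q0 : (0 < q)%N by rewrite muln_gt0 m0 fact_gt0.
(* Besides the coefficients modulo [q], the sign of the real embedding is recorded, so that two
   elements with the same [f] have a positive quotient. *)
pose f T := ([ffun i => inord `|(c T i %% q)%Z|] : {ffun 'I_d -> 'I_q.+1}, 0 < iota (xs (c T))).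
have [t ht] : exists t, forall b, exists2 n, (b <= n)%N & f n = f t.
  by apply: infinite_fiber; apply: (@sub_finite_set _ _ setT) => //; apply: finite_finset.
have diff T : f T = f t -> exists z, mult_order z /\
    xs (c T) = xs (c t) + q%:R * z /\ xs (c t) = xs (c T) + q%:R * (- z).
  case=> /ffunP hf _.
  have hmod i : (c T i %% q)%Z = (c t i %% q)%Z.
    have := hf i; rewrite !ffunE => /(congr1 (@nat_of_ord _)); rewrite !inordK ?ltnS; last 2 first.
    - by have := ltz_pmod (c t i) (_ : 0 < q%:Z); lia.
    - by have := ltz_pmod (c T i) (_ : 0 < q%:Z); lia.
    by have := modz_ge0 (c t i) (_ : q%:Z != 0); have := modz_ge0 (c T i) (_ : q%:Z != 0); lia.
  pose z := xs (fun i => (c T i %/ q)%Z - (c t i %/ q)%Z).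
  have E : xs (c T) = xs (c t) + q%:R * z.
    rewrite /z /xs mulr_sumr -big_split; apply: eq_bigr => i _ /=.
    rewrite {1}(divz_eq (c T i) q) {1}(divz_eq (c t i) q) hmod.
    by rewrite !(rmorphD, rmorphM, rmorphN) /=; ring.
  exists z; split; first exact: xs_order.
  by split; [exact: E|rewrite E mulrN addrK].
set y := xs (c t) in diff *.
have y0 : y != 0 := xs0 t.
pose C2 : R := \sum_i \sum_j `|ratr (mulmat y^-1 i j)|.
have C2_ge0 : 0 <= C2 by do 2!(apply: sumr_ge0 => ? _).
pose C3 := d%:R * C1 * C2.
have C3_ge0 : 0 <= C3 by rewrite !mulr_ge0.
pose C4 := C / `|iota y|.
have C4_ge0 : 0 <= C4 by rewrite divr_ge0 // ltW.
(* Let r = T + 1. For a non-generating quotient the real embedding, at most C4 / r^(d - 1), occurs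
   twice in the bound, while d - 2 rows have entries at most C3 r. This gives r^d <= M, so taking r
   > M excludes the case. *)
pose M := d`!%:R * (C4 * Vm * C4 * C3 ^+ d.-2) / V0.
have [T hT fT] := ht (Num.truncn M).+1.
have [z [hz [Ez Ez']]] := diff _ fT.
set x := xs (c T) in Ez Ez'.
have x0 : x != 0 := xs0 T.
have [nx hnx nxb] := norm_le T; have [ny hny nyb] := norm_le t.
have ox := xs_order (c T); have oy := xs_order (c t).
have hN : mult_order (- z) by apply: (subringN hO).
have e1 : order_mod m (x / y) := order_mod_quotient y0 oy hz hny nyb Ez.
have e2 : order_mod m (y / x) := order_mod_quotient x0 ox hN hnx nxb Ez'.
have EV : (x / y)^-1 = y / x by rewrite invf_div.
exists (x / y); split=> //; last 1 first.
- apply: contrapT => ngen.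
  have n1 : `|fnorm (x / y)| = 1.
    have [k1 hk1] := order_fnorm (order_mod_order e1).
    have [k2 hk2] := order_fnorm (order_mod_order e2).
    have : fnorm (x / y) * fnorm (y / x) = 1.
      rewrite /fnorm -det_mulmx -mulmatM mulrA divfK // divff // mulmat1 det1 //.
    rewrite hk1 hk2 -rmorphM -[1]/(1%:~R) => /intr_inj h.
    have : `|k1|%N = 1%N.
      apply/eqP; rewrite -dvdn1.
      by have := dvdn_mulr `|k2|%N (dvdnn `|k1|%N); rewrite -abszM h.
    by rewrite -intr_norm => h'; rewrite (_ : `|k1| = 1) // -abszE h'.
  have hC3 i j : `|ratr (mulmat (x / y) i j) : R| <= C3 * T.+1%:R.
    rewrite mulmatM mxE rmorph_sum (le_trans (ler_norm_sum _ _ _)) //.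
    have -> : C3 * T.+1%:R = \sum_(k < d) (C1 * T.+1%:R) * C2.
      by rewrite sumr_const card_ord /C3 -mulr_natl; ring.
    apply: ler_sum => k _; rewrite rmorphM normrM ler_pM //=; first exact: entries.
    rewrite /C2 (bigD1 k) //= (bigD1 j) //= -addrA lerDl addr_ge0 //.
      by apply: sumr_ge0.
    by do 2!(apply: sumr_ge0 => ? _).
  have := nongenerating_unit_bound iota i0 hC3 n1 ngen.
  rewrite -/V0 -/Vm => h.
  have small : `|iota (x / y)| * T.+1%:R ^+ d.-1 <= C4.
    rewrite fmorph_div normrM normfV mulrAC ler_wpM2r // ?invr_ge0 //.
    by have [_ _ h3] := hc T.
  set s := `|iota (x / y)| in h small; set r : R := T.+1%:R in h small hC3.
  have r1 : 1 <= r by rewrite ler1n.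
  have r0 : 0 <= r := le_trans ler01 r1.
  have dE : d = (d.-2).+2 by case: (d) d1 => [|[|]].
  have rd2 : r ^+ d = r ^+ d.-2 * r ^+ 2 by rewrite -exprD addn2 -dE.
  have rd1 : r ^+ d.-1 = r ^+ d.-2 * r by rewrite -exprSr; congr (_ ^+ _); case: (d) d1 => [|[|]].
  have s2 : (s * r ^+ d.-1) ^+ 2 <= C4 ^+ 2.
    by rewrite lerXn2r ?nnegrE // mulr_ge0 ?exprn_ge0 // normr_ge0.
  have key : V0 * r <= d`!%:R * (C4 * Vm * C4 * C3 ^+ d.-2).
    have rd : r <= r ^+ d by rewrite -{1}[r]expr1 ler_weXn2l // ltnW.
    apply: le_trans (ler_wpM2l (ltW V0_gt0) rd) _.
    apply: le_trans (ler_wpM2r (exprn_ge0 d r0) h) _.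
    have -> : d`!%:R * (s * Vm * s * (C3 * r) ^+ d.-2) * r ^+ d =
        d`!%:R * (Vm * C3 ^+ d.-2) * (s * r ^+ d.-1) ^+ 2.
      rewrite exprMn rd2 rd1; move: (r ^+ d.-2) (C3 ^+ d.-2) (d`!%:R) => u v k.
      by ring.
    have -> : d`!%:R * (C4 * Vm * C4 * C3 ^+ d.-2) = d`!%:R * (Vm * C3 ^+ d.-2) * C4 ^+ 2.
      by move: (C3 ^+ d.-2) (d`!%:R) => v k; ring.
    by rewrite ler_wpM2l // !mulr_ge0 // exprn_ge0.
  have M0 : 0 <= M.
    apply: divr_ge0; last exact: ltW.
    apply: mulr_ge0 => //; apply: mulr_ge0; last exact: exprn_ge0.
    by apply: mulr_ge0 => //; apply: mulr_ge0.
  have rM : r <= M by rewrite /M ler_pdivlMr // mulrC.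
  have /andP [_ MT] := truncn_itv M0.
  have : (Num.truncn M).+1%:R <= r by rewrite ler_nat; apply: leq_trans hT _.
  by rewrite leNgt (le_lt_trans rM MT).
- rewrite fmorph_div; have [_ sgn] := fT.
  have iy0 : iota y != 0 by rewrite fmorph_eq0.
  have ix0 : iota x != 0 by rewrite fmorph_eq0.
  have [yp|yn] := ltP 0 (iota y); first by rewrite divr_gt0 // sgn.
  have xn : iota x < 0 by rewrite lt_neqAle ix0 leNgt sgn -leNgt.
  by rewrite nmulr_rgt0 // invr_lt0 lt_neqAle iy0.
- by rewrite EV.
Qed.

End UnitsModulo.

(** * Infinitely many orbits over a proper extension of the rationals *)

Section FieldExtension.
Variables (R : realType) (K : fieldExtType rat) (iota : {rmorphism K -> R}).

Lemma mulmat_inj : injective (@mulmat K).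
Proof.
move=> x y h; pose i := Ordinal (fbasis_dim_gt0 K).
by apply: (mulfI (fbasis_neq0 i)); rewrite !mulmatE h.
Qed.

Lemma mulmat_int (k : int) : mulmat (k%:~R : K) = map_mx intr (k%:M : 'M[int]_(\dim {:K})).
Proof.
by rewrite map_scalar_mx -[k%:~R](rmorph_int (in_alg K)) mulmatZ mulmat1 scalemx1.
Qed.

(** The matrix of [x] is congruent to a scalar matrix modulo m; once m exceeds twice a bound on its
    entries, it is scalar. *)
Lemma order_mod_integer (x : K) : mult_order x ->
  (forall b, exists2 m, (b <= m)%N & order_mod m x) -> exists k : int, x = k%:~R.
Proof.
move=> [A hA] hx; pose i0 := Ordinal (fbasis_dim_gt0 K).
pose b := (\sum_i \sum_j `|A i j|)%N.
have Ab i j : (`|A i j| <= b)%N by rewrite /b (bigD1 i) //= (bigD1 j) //= -addnA leq_addr.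
clearbody b; have [m bm [k [u [[U hU] xE]]]] := hx (b + b).+1.
have E i j : A i j = k *+ (i == j) + m%:Z * U i j.
  have := congr1 (@mulmat K) xE; rewrite mulmatD mulmat_int hA.
  have -> : m%:R * u = (m%:R : rat) *: u by rewrite -mulr_algl -[_%:A]/(in_alg K _) rmorph_nat.
  rewrite mulmatZ hU => /matrixP /(_ i j); rewrite !mxE.
  by rewrite -[m%:R]/(m%:Z%:~R) -rmorphM -rmorphD => /intr_inj.
have small (z w : int) : z = m%:Z * w -> (`|z| <= b + b)%N -> z = 0.
  move=> -> ; rewrite abszM absz_nat => h.
  have [->|w0] := eqVneq w 0; first by rewrite mulr0.
  have : (m <= m * `|w|)%N by rewrite leq_pmulr // absz_gt0.
  by move: (m * _)%N h; lia.
exists (A i0 i0); apply: mulmat_inj; rewrite mulmat_int hA; congr map_mx.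
apply/matrixP => i j; rewrite mxE; have [<-|ij] := eqVneq i j.
  rewrite mulr1n; apply/eqP; rewrite -subr_eq0; apply/eqP.
  apply: (small _ (U i i - U i0 i0)); first by rewrite !E !eqxx; ring.
  by have := Ab i i; have := Ab i0 i0; lia.
rewrite mulr0n; apply: (small _ (U i j)); first by rewrite E (negPf ij) add0r.
exact: leq_trans (Ab i j) (leq_addr _ _).
Qed.

Lemma order_S_integers (S : set (finite_place K)) x : mult_order x -> S_integers S x.
Proof. by move=> hx v _; apply: order_place. Qed.

Lemma rational_of_generates (r : rat) : generates (r%:A : K) ->
  range iota = range (@ratr R).
Proof.
move=> gen; rewrite eqEsubset; split=> _ [x _ <-]; last by exists (x%:A); rewrite ?iota_rat.
have [p ->] := gen x; exists p.[r] => //.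
by rewrite -[r%:A]/(in_alg K r) horner_map -(iota_rat iota).
Qed.

Lemma fext_dim_gt1 : range iota <> range (@ratr R) -> (1 < \dim {:K})%N.
Proof.
move=> KQ; rewrite ltnNge; apply/negP => d1; apply: KQ.
have full : (1%VS == {:K})%VS by rewrite eqEdim subvf dimv1.
apply: (@rational_of_generates 1) => x.
have : x \in 1%VS by rewrite (eqP full) memvf.
by move=> /vlineP [k ->]; exists k%:P; rewrite map_polyC hornerC.
Qed.

(** With finitely many orbits, some point with parameter g would share its orbit with points for
    arbitrarily large moduli. Its coordinates X and Z would then be integers, making g = (2 - Z) /
    (2 - X) rational although it generates K. *)
Lemma infinite_orbits_extension (S : set (finite_place K)) :
  range iota <> range (@ratr R) ->
  ~ finite_set [set mcg_orbit q | q in @teichmuller R `&` S_integral_points iota S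
                                     `&` [set q | trace_field q = range iota]].
Proof.
move=> KQ fin; have d1 := fext_dim_gt1 KQ.
have /choice [e he] : forall m : nat, exists e : K,
    [/\ 0 < iota e, order_mod m.+1 e, order_mod m.+1 e^-1 & generates e].
  by move=> m; apply: units_modulo.
have e0 m : e m != 0 by rewrite -(fmorph_eq0 iota) gt_eqF //; have [] := he m.
pose f m := mcg_orbit (fam_pt (iota (e m))).
have [t ht] : exists t, forall b, exists2 n, (b <= n)%N & f n = f t.
  apply: infinite_fiber; apply: sub_finite_set fin => _ [n _ <-].
  have [h1 h2 h3 h4] := he n; exists (fam_pt (iota (e n))) => //; split; first split.
  - exact: fam_pt_teichmuller.
  - by apply: fam_pt_S_integral; apply/order_S_integers/order_mod_order; eassumption.
  - exact: fam_trace_field.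
have [gt0 ot oVt gt] := he t; set g := e t in ht gt0 ot oVt gt.
have trace_mod n : f n = f t -> order_mod n.+1 (2 - (2 + g) ^+ 2 / g) /\
    order_mod n.+1 (2 - (2 + g) ^+ 2).
  move=> fnt; have [n1 n2 n3 _] := he n.
  have : mcg_orbit (fam_pt (iota (e n))) (fam_pt (iota g)).
    rewrite -[mcg_orbit _]/(f n) fnt; apply: mcg_orbit_refl; last exact: fam_pt_neq2.
    by have [] := fam_pt_teichmuller gt0.
  move=> /(fam_orbit n1) [h1 [h2 [h3]]].
  rewrite fam_pt_map => -[/(fmorph_inj iota) E1 _ /(fmorph_inj iota) E3].
  have hL := order_mod_subring K n.+1.
  have tr_mod h : order_mod n.+1 (\tr (fam_rep (e n) h)).
    by apply: (subring_sum hL) => i _; apply: (fam_rep_entries hL n2 n3 (e0 n)).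
  by split; [move: E1|move: E3]; rewrite /fam_pt /= => ->.
have hO := order_subring K.
have [oG oV] := (order_mod_order ot, order_mod_order oVt).
have o2 : mult_order (2 : K) := subring_nat hO 2.
have os : mult_order ((2 + g) ^+ 2) by apply: (subringX hO); apply: (subringD hO).
have [a Ea] : exists a : int, 2 - (2 + g) ^+ 2 / g = a%:~R.
  apply: order_mod_integer; first by apply: (subringB hO) => //; apply: (subringM hO).
  move=> b; have [n bn fn] := ht b; exists n.+1; first exact: leqW.
  by have [] := trace_mod n fn.
have [c Ec] : exists c : int, 2 - (2 + g) ^+ 2 = c%:~R.
  apply: order_mod_integer; first exact: (subringB hO).
  move=> b; have [n bn fn] := ht b; exists n.+1; first exact: leqW.
  by have [] := trace_mod n fn.
have s0 : (2 + g) ^+ 2 != 0.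
  rewrite expf_neq0 // -(fmorph_eq0 iota) rmorphD rmorph_nat gt_eqF //.
  by rewrite addr_gt0.
have g0 : g != 0 := e0 t.
have gE : g = ((2 - c)%:~R / (2 - a)%:~R : rat)%:A.
  rewrite -[_%:A]/(in_alg K _) fmorph_div !rmorph_int !rmorphB /= -Ea -Ec.
  by field; rewrite g0 opprB addrC subrK.
by apply: KQ; apply: (@rational_of_generates ((2 - c)%:~R / (2 - a)%:~R)); rewrite -gE.
Qed.

End FieldExtension.

Theorem theorem5p1 (R : realType) (K : fieldExtType rat)
    (iota : {rmorphism K -> R}) (S : set (finite_place K)) (finS : finite_set S) :
  finite_set [set mcg_orbit p | p in @teichmuller R `&` S_integral_points iota S
                                     `&` [set p | trace_field p = range iota]]
  <-> range iota = range (@ratr R) /\ S = set0.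
Proof.
split=> [fin|[KQ ->]]; last first.
  apply: sub_finite_set (finite_integral_orbits KQ) => _ [p [hp _] <-].
  by exists p.
have KQ : range iota = range (@ratr R).
  by apply: contrapT => /infinite_orbits_extension; apply; apply: fin.
split=> //; rewrite -subset0 => v Sv.
(* The place [v] lies over a prime [p], and its membership in [S] allows [p] as a denominator. *)
have [p p_prime vp] := place_prime KQ v.
by case: (infinite_orbits_inverted_prime KQ p_prime Sv vp fin).
Qed.
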